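(* Let $\tau$ be a veering triangulation of $M$ and suppose $\mathrm{rank}\,H_1(M)>1$. Let $c_1,\dots,c_n$ be the $AB$-cycles of $\tau$, of lengths $k_i$ and classes $g_i=[c_i]\in G$. Then, up to multiplication by a unit $\pm g$ of $\mathbb{Z}[G]$, $$V_\tau=V^{\mathcal{AB}}_\tau\cdot\Theta_\tau=\Theta_\tau\cdot\prod_{i=1}^n\left(1+(-1)^{k_i+1}g_i\right).$$
   Context: $\tau$ is a veering triangulation of $M$ (taut ideal triangulation with cooriented faces, each tetrahedron having two bottom and two top faces, a bottom edge, a top edge and four side edges, angle sum $2\pi$ around edges, with a consistent right/left veer on edges modelled on a thickened rhombus whose side edges of positive slope are right-veering and of negative slope left-veering); $E,F$ its sets of edges and faces. $G=H_1(M;\mathbb{Z})/\mathrm{torsion}$ (multiplicative), $\hat M$ the cover with deck group $G$, $\tilde\tau$ the lift; choose lifts of edges and faces. Veering polynomial: $V_\tau=\det L$, $L:\mathbb{Z}[G]^E\to\mathbb{Z}[G]^E$ sending each edge $\mathbf b$ to $\mathbf b-(\mathbf t+\mathbf s_1+\mathbf s_2)$, where $\mathbf t$ is the top edge and $\mathbf s_1,\mathbf s_2$ the side edges with veer opposite to $\mathbf t$ of the lifted tetrahedron whose bottom edge is $\mathbf b$. Taut polynomial: each face $f$ is a bottom face of a unique tetrahedron whose bottom edge $\mathbf b$ lies in $f$; with $\mathbf x,\mathbf y$ the other edges of $f$, $L^\triangle:\mathbb{Z}[G]^F\to\mathbb{Z}[G]^E$ sends $f\mapsto\mathbf b-(\mathbf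 x+\mathbf y)$, and $\Theta_\tau$ is the gcd of the $|E|\times|E|$ minors of $L^\triangle$. $AB$-cycles: for a face $f$ with $t$ the tetrahedron having $f$ as a bottom face, $A(f)$ is the top face of $t$ meeting $f$ along the edge of $t$ with the same veer as the top edge of $t$; the cycles of the permutation $A$ of $F$ are the $AB$-cycles, the length is the number of faces, and each determines a closed directed curve in $M$ with class in $G$. $V^{\mathcal{AB}}_\tau=\det(I+A)$ for the lift of $A$ to $\mathbb{Z}[G]^F$. *)

(* Defs.v *)
From HB Require Import structures.
From mathcomp Require Import all_boot all_algebra all_fingroup.
From mathcomp Require Import mpoly.

Set Implicit Arguments.
Unset Strict Implicit.
Unset Printing Implicit Defensive.

Import GRing.Theory.
Local Open Scope ring_scope.

(* Combinatorial model of an (oriented, ideal) triangulation with a taut      *)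
(* structure and an edge colouring (the veer).                                *)
(*  - Tet : the tetrahedra; each tetrahedron has vertices 'I_4, which are     *)
(*    assumed positively ordered (orientation of M); the face slot (t,k) is   *)
(*    the face of t opposite to vertex k.                                     *)
(*  - glue x : the face slot glued to the face slot x, via the vertex         *)
(*    bijection gperm x : 'I_4 -> 'I_4 (vertices of x.1 -> vertices of        *)
(*    (glue x).1).                                                            *)
(*  - topf t k : the face of t opposite to k is a top face of t (coorientation)*)
(*  - Fac, face_of : the set of faces of the triangulation, with the map      *)
(*    sending a face slot to its face.                                        *)
(*  - Edg, edge_of t i j : the set of edges, with the map sending the edge    *)
(*    {i,j} of t to its edge.                                                 *)
(*  - right_veer e : e is right veering (otherwise left veering).             *)
Record triangulation := Triangulation {
  Tet : finType;
  glue : Tet * 'I_4 -> Tet * 'I_4;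
  gperm : Tet * 'I_4 -> {perm 'I_4};
  topf : Tet -> 'I_4 -> bool;
  Fac : finType;
  face_of : Tet * 'I_4 -> Fac;
  Edg : finType;
  edge_of : Tet -> 'I_4 -> 'I_4 -> Edg;
  right_veer : Edg -> bool
}.

Section Triangulation.
Variable tau : triangulation.

Local Notation Tet := (@Tet tau).
Local Notation glue := (@glue tau).
Local Notation gperm := (@gperm tau).
Local Notation topf := (@topf tau).
Local Notation Fac := (@Fac tau).
Local Notation face_of := (@face_of tau).
Local Notation Edg := (@Edg tau).
Local Notation edge_of := (@edge_of tau).
Local Notation right_veer := (@right_veer tau).

(* oriented edge slots (t, i, j) : the edge i -> j of the tetrahedron t *)
Definition oslot := (Tet * 'I_4 * 'I_4)%type.

Definition edge_step : rel oslot := fun x y =>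
  let: (t, i, j) := x in let: (t', i', j') := y in
  (i != j) && [exists k : 'I_4, [&& k != i, k != j, (glue (t, k)).1 == t',
                                    gperm (t, k) i == i' & gperm (t, k) j == j']].

Definition tet_adj : rel Tet := fun t t' => [exists k : 'I_4, (glue (t, k)).1 == t'].

(* parity of the ordered 4-tuple of vertices (a,b,c,d): even iff it is      *)
(* positively oriented (the vertex order 0,1,2,3 being positive)            *)
Definition even4 (a b c d : 'I_4) : bool :=
  let s := [:: a; b; c; d] in
  ~~ odd (\sum_(p < 4) \sum_(q < 4 | (p < q)%N)
            ((nth a s q < nth a s p)%N : nat))%N.

(* the edge {i,j} of t has angle pi (it is the top or the bottom edge of t) *)
Definition pi_angle (t : Tet) (i j : 'I_4) : bool := topf t i == topf t j.

Record veering_triangulation : Prop := {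
  glue_invol : forall x, glue (glue x) = x;
  glue_nofix : forall x, glue x != x;
  gperm_face : forall x, gperm x x.2 = (glue x).2;
  gperm_glue : forall x, gperm (glue x) = ((gperm x)^-1)%g;
  gperm_odd : forall x, odd_perm (gperm x); (* orientation-reversing gluings *)
  face_of_fiber : forall x y, face_of x = face_of y <-> y = x \/ y = glue x;
  face_of_surj : forall f, exists x, face_of x = f;
  edge_of_sym : forall t i j, edge_of t i j = edge_of t j i;
  edge_of_fiber : forall t i j t' i' j', i != j -> i' != j' ->
    (edge_of t i j = edge_of t' i' j' <->
     connect edge_step (t, i, j) (t', i', j') \/
     connect edge_step (t, i, j) (t', j', i'));
  edge_of_surj : forall e, exists t i j, i != j /\ edge_of t i j = e;
  (* no edge is identified with itself in reverse (M is a manifold) *)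
  no_edge_reversal : forall t i j, i != j -> ~~ connect edge_step (t, i, j) (t, j, i);
  tet_connected : forall t t', connect tet_adj t t';
  two_top : forall t, #|[set k | topf t k]| = 2%N;
  coorient : forall x, topf x.1 x.2 != topf (glue x).1 (glue x).2;
  (* angle sum 2 pi around each edge: exactly two pi angles *)
  angle_sum : forall e, #|[set x : oslot | [&& (x.1.2 < x.2)%N,
                          edge_of x.1.1 x.1.2 x.2 == e & pi_angle x.1.1 x.1.2 x.2]]| = 2%N;
  (* veering: for the tetrahedron t with bottom edge {a,b} (vertices opposite *)
  (* the top faces) and top edge {c,d}, with (a,b,c,d) positively oriented,  *)
  (* the side edges ac, bd (positive slope) are right veering and ad, bc     *)
  (* (negative slope) are left veering                                       *)
  veer : forall t a b c d,
    [&& a != b, c != d, topf t a, topf t b, ~~ topf t c, ~~ topf t d & even4 a b c d] ->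
    right_veer (edge_of t a c) /\ ~~ right_veer (edge_of t a d)
}.

(* Homology. H_1(M) is computed from the dual spine: dual vertices = Tet,     *)
(* dual edges = Fac (oriented upwards), dual 2-cells = Edg.                   *)

Definition dual_cycle (c : Fac -> int) : Prop :=
  forall t : Tet, \sum_(k < 4) (if topf t k then - c (face_of (t, k)) else c (face_of (t, k))) = 0.

(* lam is a lift rule for the dual cochain om: the edge slot (t,i,j) of the  *)
(* copy g of t in the cover defined by om is the lift (g + lam t i j) of its *)
(* edge, where the top face (t,k) of the copy g of t is glued to the bottom  *)
(* face of the copy g + om (face_of (t,k)) of the tetrahedron above it       *)
Definition lift_rule (V : zmodType) (om : Fac -> V) (lam : Tet -> 'I_4 -> 'I_4 -> V) : Prop :=
  (forall t i j, lam t i j = lam t j i) /\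
  (forall t k i j, topf t k -> i != j -> k != i -> k != j ->
     lam t i j = om (face_of (t, k)) + lam (glue (t, k)).1 (gperm (t, k) i) (gperm (t, k) j)).

(* om vanishes on the boundaries of the dual 2-cells (it is a cocycle) *)
Definition dual_cocycle (V : zmodType) (om : Fac -> V) : Prop :=
  exists lam, lift_rule om lam.

(* om : Fac -> Z^r induces an isomorphism H_1(M)/torsion = G ~= Z^r *)
Definition G_identification (r : nat) (om : Fac -> 'rV[int]_r) : Prop :=
  [/\ dual_cocycle om,
      (forall v : 'rV[int]_r, exists c, dual_cycle c /\ \sum_f om f *~ c f = v) &
      (forall c, dual_cycle c -> \sum_f om f *~ c f = 0 ->
         forall eta : Fac -> int, dual_cocycle eta -> \sum_f c f * eta f = 0)].

End Triangulation.

(* The group ring Z[G], G = Z^r, realised inside the fraction field of        *)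
(* Z[x_1,...,x_r]: its elements are p * x^v with p a polynomial, v in Z^r.    *)
Definition ZGK (r : nat) := {fraction {mpoly int[r]}}.

(* the group element v in Z[G] *)
Definition mono (r : nat) (v : 'rV[int]_r) : ZGK r :=
  \prod_(i < r) (FracField.tofrac ('X_i : {mpoly int[r]})) ^ (v ord0 i).

Definition inZG (r : nat) (x : ZGK r) : Prop :=
  exists (p : {mpoly int[r]}) (v : 'rV[int]_r), x = FracField.tofrac p * mono v.

Definition dvdZG (r : nat) (a b : ZGK r) : Prop :=
  exists c, inZG c /\ b = c * a.

Definition assocZG (r : nat) (a b : ZGK r) : Prop :=
  exists (s : bool) (g : 'rV[int]_r), a = (-1) ^+ s * mono g * b.

Definition detI (I : finType) (R : comPzRingType) (M : I -> I -> R) : R :=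
  \sum_(s : {perm I}) (-1) ^+ s * \prod_(i : I) M i (s i).

Section Polynomials.
Variables (tau : triangulation) (r : nat).
Variables (om : Fac tau -> 'rV[int]_r)
          (lam : Tet tau -> 'I_4 -> 'I_4 -> 'rV[int]_r)
          (nu : Fac tau -> 'rV[int]_r).
(* om : the cover; lam : the choice of lifts of edges; nu : the choice of    *)
(* lifts of faces (the lift of f is the bottom face of the copy nu f of the  *)
(* tetrahedron above f).                                                     *)

Local Notation Tet := (@Tet tau).
Local Notation topf := (@topf tau).
Local Notation Fac := (@Fac tau).
Local Notation face_of := (@face_of tau).
Local Notation Edg := (@Edg tau).
Local Notation edge_of := (@edge_of tau).
Local Notation right_veer := (@right_veer tau).

(* the matrix of L (entry (e', e) = coefficient of e' in L(e)) *)
Definition Lmat (e' e : Edg) : ZGK r :=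
  (e' == e)%:R -
  \sum_(t : Tet) \sum_(a < 4) \sum_(b < 4) \sum_(c < 4) \sum_(d < 4)
    if [&& (a < b)%N, (c < d)%N, topf t a, topf t b, ~~ topf t c, ~~ topf t d
           & edge_of t a b == e] then
      (* top edge *)
      (edge_of t c d == e')%:R * mono (lam t c d - lam t a b) +
      (* the two side edges with veer opposite to the top edge *)
      \sum_(uv <- [:: (a, c); (a, d); (b, c); (b, d)])
         (if (right_veer (edge_of t uv.1 uv.2) != right_veer (edge_of t c d))
             && (edge_of t uv.1 uv.2 == e')
          then mono (lam t uv.1 uv.2 - lam t a b) else 0)
    else 0.

Definition veering_poly : ZGK r := detI Lmat.

(* the matrix of L^triangle (entry (e, f) = coefficient of e in L^tri(f)) *)
Definition LDmat (e' : Edg) (f : Fac) : ZGK r :=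
  \sum_(t : Tet) \sum_(k < 4) \sum_(l < 4) \sum_(a < 4) \sum_(b < 4)
    if [&& face_of (t, k) == f, ~~ topf t k, ~~ topf t l, l != k,
           (a < b)%N, topf t a & topf t b] then
      (edge_of t a b == e')%:R * mono (nu f + lam t a b)
      - (edge_of t a l == e')%:R * mono (nu f + lam t a l)
      - (edge_of t b l == e')%:R * mono (nu f + lam t b l)
    else 0.

(* the |E| x |E| minors of L^triangle (up to sign) *)
Definition LDminor (iota : {ffun Edg -> Fac}) : ZGK r :=
  detI (fun e' e => LDmat e' (iota e)).

Definition is_taut_poly (Theta : ZGK r) : Prop :=
  [/\ inZG Theta,
      (forall iota : {ffun Edg -> Fac}, injective iota -> dvdZG Theta (LDminor iota)) &
      (forall d, inZG d ->
         (forall iota : {ffun Edg -> Fac}, injective iota -> dvdZG d (LDminor iota)) ->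
         dvdZG d Theta)].

(* A(f) = f' : f bottom face (t,k) of t, {k,l} the top edge of t, v a bottom *)
(* vertex with the side edge {v,l} of the same veer as the top edge, and     *)
(* f' = the top face of t opposite the other bottom vertex w                 *)
Definition ABcond (f f' : Fac) (t : Tet) (k l v w : 'I_4) : bool :=
  [&& face_of (t, k) == f, ~~ topf t k, ~~ topf t l, l != k, topf t v, topf t w,
      w != v, right_veer (edge_of t v l) == right_veer (edge_of t k l)
      & face_of (t, w) == f'].

Definition ABrel (f f' : Fac) : bool :=
  [exists t, exists k, exists l, exists v, exists w, ABcond f f' t k l v w].

Definition Aperm (f : Fac) : Fac := odflt f [pick f' | ABrel f f'].

(* the lift of A to Z[G]^F (entry (f', f) = coefficient of f' in A(f)) *)
Definition Amat (f' f : Fac) : ZGK r :=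
  \sum_(t : Tet) \sum_(k < 4) \sum_(l < 4) \sum_(v < 4) \sum_(w < 4)
    if ABcond f f' t k l v w then mono (nu f + om f' - nu f') else 0.

Definition AB_poly : ZGK r := detI (fun f' f => (f' == f)%:R + Amat f' f).

(* product over the AB-cycles c (orbits of A, represented by their roots) of *)
(* 1 + (-1)^(k+1) [c], k the length of c, [c] = sum of om over its faces     *)
Definition AB_product : ZGK r :=
  \prod_(f : Fac | froot Aperm f == f)
     (1 + (-1) ^+ (fingraph.order Aperm f).+1 * mono (\sum_(g <- fingraph.orbit Aperm f) om g)).

End Polynomials.

(* Main.v *)
Require Import Defs.
From mathcomp Require Import all_boot all_order all_algebra all_fingroup.
From mathcomp Require Import mpoly.
From mathcomp Require Import ring zify.
Set Implicit Arguments.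
Unset Strict Implicit.
Unset Printing Implicit Defensive.
Import Order.TTheory GRing.Theory Num.Theory.
Local Open Scope ring_scope.

(** In a tetrahedron with bottom edge [ab] and top edge [cd], labelled so that
    [ac] has the veer of [cd], the map [A] sends the bottom face [abc] to the top
    face [acd], whose bottom edge, seen from the tetrahedron above, is [ac].
    Hence [L^tri (I + A) = L pi], where [pi] sends a face to the bottom edge of
    the tetrahedron above it.  Completing [L^tri] by rows of the identity and
    using a basis of [ker pi], one gets for every set [S] of [|E|] faces
      [det (I + A) * minor_S (L^tri) = unit * det L * minor_S' ((I + A) | ker pi)]
    with [S'] the complement of [S].  The matrix [(I + A) | ker pi] is, up to
    units, the incidence matrix of the dual graph of the triangulation with
    gains in [{1,-1} x G]; its minor on a spanning tree and one more edge is a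
    unit times [1 +- g], [g] the class of the resulting circuit.  These classes
    span [G], so if [rank G > 1] two of them are independent, and then the two
    minors form a regular sequence in [Z[G]]; thus [det (I + A) * Theta] and
    [det L] divide each other, and the units of [Z[G]] are the [+-g]. *)

(** * Determinants indexed by finite types *)

Section DetI.
Variable R : comPzRingType.

(** The obstacle is that [Theta] is known only through its universal property as a gcd. A single
    minor relation therefore gives [det (I + A) * c * Theta = det L * (1 - e g)] with [e] a sign and
    an unknown cofactor [c]. Eliminating [det L] between two such relations leaves
    [c1 * (1 - e2 g2) = c2 * (1 - e1 g1)], and regularity puts [1 - e1 g1] into [c1], so that
    [det L = w * det (I + A) * Theta]. Put back into the minor relations, this makes [w * Theta] a
    common divisor of the minors, hence a divisor of [Theta], and [w] a unit. In rank one the two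
    binomials may share a factor such as [1 - t]; in higher rank a linear form can vanish on one
    class and not on the other, and regularity is read off from the grading that it defines. *)

Lemma eq_detI (I : finType) (M N : I -> I -> R) :
  (forall i j, M i j = N i j) -> detI M = detI N.
Proof.
move=> eqMN; apply: eq_bigr => s _; congr (_ * _).
by apply: eq_bigr => i _; rewrite eqMN.
Qed.

Lemma conj_perm_inj (I J : finType) (f : J -> I) (g : I -> J) (s : {perm J}) :
  cancel f g -> cancel g f -> injective (fun i => f (s (g i))).
Proof. by move=> fK gK i j /(can_inj fK)/perm_inj/(can_inj gK). Qed.

Section Conjugation.
Variables (I J : finType) (f : J -> I).
Hypothesis f_bij : bijective f.

(** Conjugation by a bijection between two different types. Parity is carried over by writing [s] as
    a product of transpositions, which conjugate to transpositions. *)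
Lemma conj_permP : exists phi : {perm J} -> {perm I},
  [/\ bijective phi, forall s j, phi s (f j) = f (s j)
     & forall s, odd_perm (phi s) = odd_perm s].
Proof.
have [g fK gK] := f_bij.
pose phi s := perm (conj_perm_inj (s := s) fK gK).
pose psi s := perm (conj_perm_inj (s := s) gK fK).
have phiE s j : phi s (f j) = f (s j) by rewrite permE fK.
have phiM : {morph phi : s t / (s * t)%g}.
  move=> s t; apply/permP => i; rewrite -(gK i) phiE !permM.
  by rewrite !phiE.
have phi1 : phi 1%g = 1%g.
  by apply/permP => i; rewrite -(gK i) phiE !perm1.
exists phi; split=> //.
  by exists psi => s; apply/permP => i; rewrite !permE ?fK ?gK.
move=> s; have [ts -> /=] := prod_tpermP s.
elim: ts => [|[x y] ts IHts] /=; first by rewrite !big_nil phi1 !odd_perm1.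
case/andP=> neq_xy /IHts{IHts} IHts; rewrite big_cons phiM !odd_permM IHts.
congr (_ (+) _); rewrite odd_tperm /= neq_xy.
suff -> : phi (tperm x y) = tperm (f x) (f y).
  by rewrite odd_tperm (inj_eq (can_inj fK)).
by apply/permP => i; rewrite -(gK i) phiE inj_tperm //; apply: can_inj fK.
Qed.

Lemma detI_reindex (M : I -> I -> R) : detI M = detI (fun x y => M (f x) (f y)).
Proof.
have [phi [phi_bij phiE odd_phi]] := conj_permP.
rewrite /detI (reindex phi) /=; last exact: onW_bij.
apply: eq_bigr => s _; rewrite odd_phi; congr (_ * _).
rewrite (reindex f) /=; last exact: onW_bij.
by apply: eq_bigr => j _; rewrite phiE.
Qed.

End Conjugation.

Lemma detI_ord n (M : 'I_n -> 'I_n -> R) : detI M = \det (\matrix_(i, j) M i j).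
Proof.
by apply: eq_bigr => s _; congr (_ * _); apply: eq_bigr => i _; rewrite mxE.
Qed.

Lemma detI_det (I : finType) (M : I -> I -> R) :
  detI M = \det (\matrix_(i < #|I|, j < #|I|) M (enum_val i) (enum_val j)).
Proof. by rewrite (detI_reindex (@enum_val_bij I)) detI_ord. Qed.

Lemma detI_mul (I : finType) (M N : I -> I -> R) :
  detI (fun i k => \sum_j M i j * N j k) = detI M * detI N.
Proof.
rewrite !detI_det -det_mulmx; congr (\det _); apply/matrixP => i k.
rewrite !mxE (reindex (@enum_val I predT)) /=.
  by apply: eq_bigr => j _; rewrite !mxE.
by apply: onW_bij; apply: enum_val_bij.
Qed.

Lemma detI_row_perm (I : finType) (s : {perm I}) (M : I -> I -> R) :
  detI (fun i j => M (s i) j) = (-1) ^+ s * detI M.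
Proof.
rewrite /detI big_distrr (reindex (fun t : {perm I} => (s * t)%g)) /=; last first.
  by exists (fun t => (s^-1 * t)%g) => t _; rewrite ?mulKg ?mulKVg.
apply: eq_bigr => t _; rewrite odd_permM signr_addb mulrA; congr (_ * _).
rewrite [in RHS](reindex_inj (@perm_inj _ s)).
by apply: eq_bigr => i _; rewrite permM.
Qed.

Lemma detI_dup_col (I : finType) (M : I -> I -> R) i j :
  i != j -> (forall k, M i k = M j k) -> detI M = 0.
Proof.
move=> neq_ij eqM; rewrite detI_det.
apply: (@determinant_alternate _ _ _ (enum_rank i) (enum_rank j)) => [|k].
  by rewrite (inj_eq enum_rank_inj).
by rewrite !mxE !enum_rankK.
Qed.

Lemma detI_diag (I : finType) (d : I -> R) :
  detI (fun i j => d i *+ (i == j)) = \prod_i d i.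
Proof.
rewrite /detI (bigD1 1%g) //= odd_perm1 mul1r [X in _ + X]big1 ?addr0.
  by apply: eq_bigr => i _; rewrite perm1 eqxx.
move=> s neq_s1; have [i neq_si] : exists i, s i != i.
  apply/existsP; rewrite -negb_forall; apply: contra neq_s1 => /forallP s1.
  by apply/eqP/permP => i; rewrite perm1; apply/eqP.
by rewrite (bigD1 i) //= eq_sym (negPf neq_si) mulr0n mul0r mulr0.
Qed.

Section Blocks.
Variables (I J : finType).

Definition sum_of_ord (i : 'I_(#|I| + #|J|)) : I + J :=
  match split i with inl x => inl (enum_val x) | inr y => inr (enum_val y) end.

Lemma sum_of_ord_bij : bijective sum_of_ord.
Proof.
pose g (x : I + J) : 'I_(#|I| + #|J|) := unsplit
  (match x with inl i => inl (enum_rank i) | inr j => inr (enum_rank j) end).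
exists g => [i|[x|x]]; rewrite /g /sum_of_ord ?unsplitK ?enum_rankK //.
by rewrite -[RHS]splitK; case: (split i) => j; rewrite enum_valK.
Qed.

Variable M : I + J -> I + J -> R.

Let Mblock : \matrix_(i, j) M (sum_of_ord i) (sum_of_ord j) =
  block_mx (\matrix_(i, j) M (inl (enum_val i)) (inl (enum_val j)))
           (\matrix_(i, j) M (inl (enum_val i)) (inr (enum_val j)))
           (\matrix_(i, j) M (inr (enum_val i)) (inl (enum_val j)))
           (\matrix_(i, j) M (inr (enum_val i)) (inr (enum_val j))).
Proof.
apply/matrixP => i j; rewrite !mxE /sum_of_ord.
case: (split i) => i'; rewrite !mxE; case: (split j) => j'; by rewrite !mxE.
Qed.

Lemma detI_lblock : (forall i j, M (inl i) (inr j) = 0) ->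
  detI M = detI (fun i j => M (inl i) (inl j)) * detI (fun i j => M (inr i) (inr j)).
Proof.
move=> M0; rewrite (detI_reindex sum_of_ord_bij) detI_ord Mblock !detI_det.
rewrite -(det_lblock _ (\matrix_(i, j) M (inr (enum_val i)) (inl (enum_val j)))).
congr (\det (block_mx _ _ _ _)); by apply/matrixP => i j; rewrite !mxE M0.
Qed.

Lemma detI_ublock : (forall i j, M (inr i) (inl j) = 0) ->
  detI M = detI (fun i j => M (inl i) (inl j)) * detI (fun i j => M (inr i) (inr j)).
Proof.
move=> M0; rewrite (detI_reindex sum_of_ord_bij) detI_ord Mblock !detI_det.
rewrite -(det_ublock _ (\matrix_(i, j) M (inl (enum_val i)) (inr (enum_val j)))).
congr (\det (block_mx _ _ _ _)); by apply/matrixP => i j; rewrite !mxE M0.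
Qed.

End Blocks.

(** By induction on the depth, a shallower image [s i] is itself fixed, and injectivity turns
    [s (s i) = s i] into [s i = i]. *)
Lemma perm_forest (I : finType) (P : pred I) (d : I -> nat) (s : {perm I}) :
  (forall i, P i -> s i = i) ->
  (forall i, ~~ P i -> s i = i \/ ~~ P (s i) /\ (d (s i) < d i)%N) -> s = 1%g.
Proof.
move=> sP sNP; apply/permP => i; rewrite perm1.
have [n le_n] := ubnP (d i); elim: n => // n IHn in i le_n *.
have [Pi|NPi] := boolP (P i); first exact: sP.
case: (sNP i NPi) => // -[NPs lt_d].
have /IHn /perm_inj // : (d (s i) < n)%N by apply: leq_trans lt_d _.
Qed.

(* The column operation replacing the column of each root by [M h] clears
   the roots from the other rows; the remaining entries are triangular with
   respect to the depth [d], so that only the diagonal contributes. *)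
Lemma detI_forest (I : finType) (rho : I -> I) (d : I -> nat) (h : I -> R)
    (M : I -> I -> R) :
  (forall i, rho (rho i) = rho i) ->
  (forall i j, rho i != rho j -> M i j = 0) ->
  (forall i, rho i = i -> h i = 1) ->
  (forall i, rho i != i -> \sum_j M i j * h j = 0) ->
  (forall i j, rho i != i -> i != j -> (d i <= d j)%N -> M i j = 0) ->
  detI M = \prod_i (if rho i == i then \sum_j M i j * h j else M i i).
Proof.
move=> rhoK M0 h1 Mh Md.
pose C i j := if rho j == j then h i *+ (rho i == j) else (1 : R) *+ (i == j).
have perm_id (N : I -> I -> R) :
    (forall s : {perm I}, s != 1%g -> exists i, N i (s i) == 0) ->
    detI N = \prod_i N i i.
  move=> N0; rewrite /detI (bigD1 1%g) //= odd_perm1 mul1r [X in _ + X]big1 ?addr0.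
    by apply: eq_bigr => i _; rewrite perm1.
  by move=> s /N0[i /eqP Ni0]; rewrite (bigD1 i) //= Ni0 mul0r mulr0.
have detC : detI C = 1.
  rewrite perm_id => [|s ns1].
    apply: big1 => i _; rewrite /C eqxx; case: eqP => // ri.
    by rewrite h1.
  apply/existsP; apply: contraNT ns1 => /existsPn sC; apply/eqP.
  apply: (@perm_forest _ (fun i => rho i == i) (fun=> 0%N)) => i.
    move/eqP=> ri; have := sC i; rewrite /C ri.
    by case: (i =P s i) => [<- //|_]; rewrite !mulr0n if_same eqxx.
  move=> ri; have := sC i; rewrite /C; case: ifP => [/eqP rs|_]; last first.
    by case: (i =P s i) => [<-|_]; [left | rewrite eqxx].
  case: (rho i =P s i) => [rsi _|_]; last by rewrite eqxx.
  have rr : s (rho i) = rho i.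
    have := sC (rho i); rewrite /C rhoK.
    by case: (rho i =P s (rho i)) => [<- //|_]; rewrite !mulr0n if_same eqxx.
  have /perm_inj ir : s i = s (rho i) by rewrite rr rsi.
  by rewrite -ir eqxx in ri.
transitivity (detI M * detI C); first by rewrite detC mulr1.
rewrite -detI_mul.
have MC i j : \sum_k M i k * C k j =
    if rho j == j then (if rho i == j then \sum_k M i k * h k else 0) else M i j.
  rewrite /C; case: eqP => rj.
    case: eqP => rij.
      apply: eq_bigr => k _; case: eqP => // rk; rewrite M0 ?mul0r //.
      by rewrite rij eq_sym; apply/eqP.
    apply: big1 => k _; case: eqP => [rk|]; last by rewrite mulr0.
    by rewrite M0 ?mul0r // rk; apply/eqP.
  rewrite (bigD1 j) //= eqxx mulr1 big1 ?addr0 // => k nkj.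
  by rewrite (negPf nkj) mulr0.
rewrite (eq_detI MC) perm_id => [|s ns1].
  by apply: eq_bigr => i _; case: eqP.
apply/existsP; apply: contraNT ns1 => /existsPn sC; apply/eqP.
have sP i : rho i != i -> rho (s i) != s i.
  move=> ri; have := sC i; case: (rho (s i) =P s i) => // rs.
  by case: (rho i =P s i) => rsi; rewrite ?eqxx // Mh ?eqxx.
have sroot i : rho (s i) == s i -> s i = rho i.
  by move=> rs; have := sC i; rewrite rs; case: (rho i =P s i) => //; rewrite eqxx.
apply: (@perm_forest _ (fun i => rho i == i) d) => i.
  (* Non-roots go to non-roots by [sP], so by counting roots go to roots. A root row meets no root
     column but its own, hence the root is fixed. *)
  move=> ri; have sroots j : rho j == j -> rho (s j) == s j.
    have sub : (s @^-1: [set j | rho j == j]) \subset [set j | rho j == j].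
      by apply/subsetP => k; rewrite !inE; apply: contraLR; apply: sP.
    have /eqP eq_sub : (s @^-1: [set j | rho j == j]) == [set j | rho j == j].
      rewrite eqEcard sub /= card_preimset //; exact: perm_inj.
    by move=> rj; have := in_set (fun j => rho j == j) j; rewrite -eq_sub !inE rj.
  by rewrite sroot ?sroots // (eqP ri).
move=> ri; have [si|nsi] := eqVneq (s i) i; [by left | right; split; first exact: sP].
rewrite ltnNge; apply: contra (sC i) => le_d.
by rewrite (negPf (sP i ri)) Md // eq_sym.
Qed.

End DetI.

(** * The group ring *)

Lemma sum_pred1_uniq (A : eqType) (M : nmodType) (s : seq A) (x : A) (z : M) :
  uniq s -> x \in s -> \sum_(y <- s | y == x) z = z.
Proof.
by move=> s_uniq xs; rewrite big_const_seq (count_uniq_mem _ s_uniq) xs /= addr0.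
Qed.

Lemma pull_out_binomial (F : fieldType) (x y e : F) :
  x != 0 -> x - e * y = x * (1 - e * (y / x)).
Proof. by move=> x_neq0; field. Qed.

Lemma cross_binomial (R : comPzRingType) (u c m1 m2 p q a b : R) :
  u * m2 = c * m1 -> u * p * (q * a) * (b * m2) = c * q * (p * b) * (a * m1).
Proof. by move=> E; ring: E. Qed.

Lemma cancel_two_monomials (F : fieldType) (w x m p q : F) :
  p != 0 -> q != 0 -> w * (x / p / q) * m * p * q = w * (x * m).
Proof. by move=> p_neq0 q_neq0; field; rewrite q_neq0 p_neq0. Qed.

Section GroupRing.
Variable r : nat.
Local Notation K := (ZGK r).
Local Notation V := 'rV[int]_r.
Local Notation P := {mpoly int[r]}.
Local Notation tf := (@FracField.tofrac P).

Lemma tofracX_neq0 (m : 'X_{1..r}) : tf 'X_[m] != 0.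
Proof.
rewrite tofrac_eq0; apply/eqP => /(congr1 (mcoeff m)) /eqP.
by rewrite mcoeffX eqxx mcoeff0.
Qed.

Lemma mono0 : mono (0 : V) = 1.
Proof. by rewrite /mono big1 // => i _; rewrite mxE expr0z. Qed.

Lemma monoD (v w : V) : mono (v + w) = mono v * mono w.
Proof.
rewrite /mono -big_split; apply: eq_bigr => i _.
by rewrite mxE expfzDr ?tofracX_neq0.
Qed.

Lemma mono_neq0 (v : V) : mono v != 0.
Proof.
by apply/prodf_neq0 => i _; rewrite expfz_neq0 ?tofracX_neq0.
Qed.

Lemma monoN (v : V) : mono (- v) = (mono v)^-1.
Proof. by apply: (mulfI (mono_neq0 v)); rewrite -monoD subrr mono0 divff ?mono_neq0. Qed.

Lemma monoB (v w : V) : mono (v - w) = mono v / mono w.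
Proof. by rewrite monoD monoN. Qed.

Definition mvec (m : 'X_{1..r}) : V := \row_i (m i)%:Z.

Lemma mono_mvec (m : 'X_{1..r}) : mono (mvec m) = tf 'X_[m].
Proof.
rewrite mpolyXE_id rmorph_prod; apply: eq_bigr => i _.
by rewrite mxE -exprnP rmorphXn.
Qed.

Lemma mvec_decomp (v : V) : exists a b, v = mvec b - mvec a.
Proof.
exists [multinom `|Num.min (v ord0 i) 0|%N | i < r].
exists [multinom `|Num.max (v ord0 i) 0|%N | i < r].
apply/rowP => i; rewrite !mxE !mnmE.
have -> : (ord0 : 'I_1) = 0 by [].
lia.
Qed.

(** Clearing denominators by a monomial turns membership into an identity of polynomials, where
    degrees and coefficients are available. *)
Lemma inZGP (x : K) : inZG x <-> exists (p : P) m, x * tf 'X_[m] = tf p.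
Proof.
split=> [[p [v ->]]|[p [m xE]]].
  have [a [b ->]] := mvec_decomp v.
  exists (p * 'X_[b]), a; rewrite monoB !mono_mvec mulrA divfK ?tofracX_neq0 //.
  by rewrite tofracM.
exists p, (- mvec m); rewrite monoN mono_mvec -xE mulfK //; exact: tofracX_neq0.
Qed.

Lemma inZG_tofrac p : inZG (tf p).
Proof. by exists p, 0; rewrite mono0 mulr1. Qed.

Lemma inZG_mono (v : V) : inZG (mono v).
Proof. by exists 1, v; rewrite tofrac1 mul1r. Qed.

Lemma inZG0 : inZG (0 : K). Proof. by rewrite -tofrac0; apply: inZG_tofrac. Qed.
Lemma inZG1 : inZG (1 : K). Proof. by rewrite -tofrac1; apply: inZG_tofrac. Qed.

Lemma inZG_D (x y : K) : inZG x -> inZG y -> inZG (x + y).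
Proof.
move=> /inZGP[p [m xE]] /inZGP[q [n yE]]; apply/inZGP.
exists (p * 'X_[n] + q * 'X_[m]), (m + n)%MM.
by rewrite mpolyXD tofracD !tofracM -xE -yE; ring.
Qed.

Lemma inZG_M (x y : K) : inZG x -> inZG y -> inZG (x * y).
Proof.
move=> [p [v ->]] [q [w ->]]; exists (p * q), (v + w).
by rewrite tofracM monoD; ring.
Qed.

Lemma inZG_N (x : K) : inZG x -> inZG (- x).
Proof. by move=> [p [v ->]]; exists (- p), v; rewrite tofracN mulNr. Qed.

Lemma inZG_B (x y : K) : inZG x -> inZG y -> inZG (x - y).
Proof. by move=> xZ yZ; apply/inZG_D/inZG_N. Qed.

Lemma inZG_sum (I : Type) (s : seq I) (Q : pred I) (F : I -> K) :
  (forall i, Q i -> inZG (F i)) -> inZG (\sum_(i <- s | Q i) F i).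
Proof. by move=> FZ; apply: big_ind => //; [apply: inZG0 | apply: inZG_D]. Qed.

Lemma inZG_prod (I : Type) (s : seq I) (Q : pred I) (F : I -> K) :
  (forall i, Q i -> inZG (F i)) -> inZG (\prod_(i <- s | Q i) F i).
Proof. by move=> FZ; apply: big_ind => //; [apply: inZG1 | apply: inZG_M]. Qed.

Lemma inZG_sign n : inZG ((-1) ^+ n : K).
Proof. by rewrite -signr_odd; case: odd; [apply/inZG_N/inZG1 | apply: inZG1]. Qed.

Lemma inZG_nat n : inZG (n%:R : K).
Proof. by rewrite -(rmorph_nat tf); apply: inZG_tofrac. Qed.

Lemma inZG_detI (I : finType) (M : I -> I -> K) :
  (forall i j, inZG (M i j)) -> inZG (detI M).
Proof.
by move=> MZ; apply: inZG_sum => s _; apply: inZG_M; [apply: inZG_sign | apply: inZG_prod].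
Qed.

(** * Regular sequences of binomials *)

Section Grading.
Variable l : V -> int.
Hypothesis lD : {morph l : v w / v + w}.

Definition graded_piece (n : int) (p : P) : P :=
  \sum_(m <- msupp p | l (mvec m) == n) p@_m *: 'X_[m].

Lemma mcoeff_graded_piece n p m :
  (graded_piece n p)@_m = if l (mvec m) == n then p@_m else 0.
Proof.
rewrite /graded_piece raddf_sum /= big_mkcond /=.
have F m' : (if l (mvec m') == n then (p@_m' *: 'X_[m'])@_m else 0) =
    if m' == m then (if l (mvec m) == n then p@_m else 0) else 0.
  rewrite mcoeffZ mcoeffX; case: (m' =P m) => [->|_]; last by rewrite mulr0 if_same.
  by rewrite mulr1.
rewrite (eq_bigr _ (fun m' _ => F m')) -big_mkcond /=.
have [m_p|m_p] := boolP (m \in msupp p).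
  by rewrite sum_pred1_uniq // msupp_uniq.
by rewrite memN_msupp_eq0 // if_same big1.
Qed.

Lemma graded_pieceD n : {morph graded_piece n : p q / p + q}.
Proof.
move=> p q; apply/mpolyP => m; rewrite mcoeffD !mcoeff_graded_piece mcoeffD.
by case: ifP => // _; rewrite addr0.
Qed.

Lemma graded_pieceZ n c p : graded_piece n (c *: p) = c *: graded_piece n p.
Proof.
apply/mpolyP => m; rewrite mcoeffZ !mcoeff_graded_piece mcoeffZ.
by case: ifP => // _; rewrite mulr0.
Qed.

Lemma graded_pieceX n m :
  graded_piece n 'X_[m] = if l (mvec m) == n then 'X_[m] else 0.
Proof.
apply/mpolyP => k; rewrite mcoeff_graded_piece mcoeffX.
case: (m =P k) => [->|/eqP/negPf neq]; first by case: ifP; rewrite ?mcoeffX ?eqxx ?mcoeff0.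
by rewrite if_same; case: ifP; rewrite ?mcoeffX ?neq ?mcoeff0.
Qed.

Lemma mvecD m m' : mvec (m + m')%MM = mvec m + mvec m'.
Proof. by apply/rowP => i; rewrite !mxE mnmDE PoszD. Qed.

Lemma graded_piece_mulX n p m :
  graded_piece n (p * 'X_[m]) = graded_piece (n - l (mvec m)) p * 'X_[m].
Proof.
elim/mpolyind: p => [|c k p _ _ IHp].
  by rewrite mul0r /graded_piece msupp0 !big_nil mul0r.
rewrite mulrDl !graded_pieceD mulrDl IHp; congr (_ + _).
rewrite -scalerAl !graded_pieceZ -scalerAl -mpolyXD !graded_pieceX mvecD lD.
by rewrite -(inj_eq (addIr (- l (mvec m)))) addrK; case: eqP; rewrite ?mul0r ?mpolyXD.
Qed.

Lemma sum_graded_piece p :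
  p = \sum_(n <- undup [seq l (mvec m) | m <- msupp p]) graded_piece n p.
Proof.
apply/mpolyP => m; rewrite raddf_sum /=.
rewrite (eq_bigr _ (fun n _ => mcoeff_graded_piece n p m)) -big_mkcond /=.
have [m_p|m_p] := boolP (m \in msupp p).
  rewrite (eq_bigl (fun n => n == l (mvec m))) => [|n]; last by rewrite eq_sym.
  by rewrite sum_pred1_uniq ?undup_uniq // mem_undup map_f.
by rewrite memN_msupp_eq0 // big1.
Qed.

Lemma graded_piece_low p : exists N : int, forall n, n < N -> graded_piece n p = 0.
Proof.
(* A crude lower bound for the degrees, which may be negative. *)
exists (- (\sum_(m <- msupp p) `|l (mvec m)|)) => n lt_n.
rewrite /graded_piece big_seq_cond big1 // => m /andP[m_p /eqP lm].
have : `|l (mvec m)| <= \sum_(m <- msupp p) `|l (mvec m)|.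
  by rewrite (big_rem m) //= lerDl; apply: sumr_ge0.
lia.
Qed.

(** The divisor [M1] is homogeneous for [l]. In degree [n + l c] the equation therefore expresses
    [u_n * X^c] as [s2 * u_m * X^d] plus a multiple of [M1], with [m = n + l c - l d < n]. As [X^c]
    is invertible in the group ring, divisibility passes from [u_m] to [u_n], and the components of
    very low degree vanish. *)
Lemma binomial_regular_graded (s1 s2 : int) a b c d (u q : P) :
  l (mvec a) = l (mvec b) -> l (mvec c) < l (mvec d) ->
  u * ('X_[c] - s2 *: 'X_[d]) = q * ('X_[a] - s1 *: 'X_[b]) ->
  exists2 w : K, inZG w & tf u = w * tf ('X_[a] - s1 *: 'X_[b]).
Proof.
move=> l_ab l_cd uq; set M1 := 'X_[a] - _ in uq *.
pose dvd (p : P) := exists2 w : K, inZG w & tf p = w * tf M1.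
have dvd0 : dvd 0 by exists 0; rewrite ?tofrac0 ?mul0r //; apply: inZG0.
have dvdD p p' : dvd p -> dvd p' -> dvd (p + p').
  move=> [w wZ pE] [w' wZ' pE']; exists (w + w'); first exact: inZG_D.
  by rewrite tofracD pE pE' mulrDl.
have pieceB n p x s y : graded_piece n (p * ('X_[x] - s *: 'X_[y])) =
    graded_piece (n - l (mvec x)) p * 'X_[x] -
    s *: (graded_piece (n - l (mvec y)) p * 'X_[y]).
  rewrite -!scaleNr mulrDr -scalerAr graded_pieceD graded_pieceZ.
  by rewrite !graded_piece_mulX.
have step n : dvd (graded_piece (n + l (mvec c) - l (mvec d)) u) ->
    dvd (graded_piece n u).
  move=> [w wZ wE].
  have := congr1 (graded_piece (n + l (mvec c))) uq; rewrite !pieceB l_ab addrK.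
  rewrite [s1 *: _]scalerAr -mulrBr -/M1 => /(congr1 tf); rewrite tofracB !tofracM.
  rewrite -mul_mpolyC tofracM tofracM wE => E.
  pose z := tf (graded_piece (n + l (mvec c) - l (mvec b)) q).
  exists ((z + tf s2%:MP * (w * tf 'X_[d])) * mono (- mvec c)).
    by do !(apply: inZG_M || apply: inZG_D || apply: inZG_tofrac || apply: inZG_mono) => //.
  apply: (mulIf (tofracX_neq0 c)).
  rewrite monoN mono_mvec mulrAC divfK ?tofracX_neq0 // mulrDl -E; ring.
have [N0 low] := graded_piece_low u.
(* Each use of [step] lowers the degree by [l d - l c], which is at least 1, so [k] bounds the
   number of uses. *)
have all_n k : forall n, n < N0 + k%:Z -> dvd (graded_piece n u).
  elim: k => [|k IHk] n lt_n; first by rewrite low //; move: lt_n; rewrite addr0.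
  by apply/step/IHk; lia.
rewrite -/(dvd u) [u]sum_graded_piece; apply: (big_ind dvd) => // n _.
by apply: (all_n `|n - N0|.+1); lia.
Qed.

End Grading.

(** With [g = b - a], the element [1 - e g] is the polynomial [X^a - e X^b] up to a monomial, so the
    graded case applies. The sign of [l g2] is normalised by passing from [l] to [- l]. *)
Lemma binomial_regular (l : V -> int) (e1 e2 : bool) (g1 g2 : V) (u c : K) :
  {morph l : v w / v + w} -> l g1 = 0 -> l g2 != 0 -> inZG u -> inZG c ->
  u * (1 - (-1) ^+ e2 * mono g2) = c * (1 - (-1) ^+ e1 * mono g1) ->
  exists2 w, inZG w & u = w * (1 - (-1) ^+ e1 * mono g1).
Proof.
wlog lt_l : l / 0 < l g2.
  move=> IH lD l1 l2; have [l_gt0|l_le0] := ltP 0 (l g2); first exact: (IH l).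
  apply: (IH (fun v => - l v)); rewrite ?l1 ?oppr_eq0 ?oppr0 //.
    by rewrite oppr_gt0 lt_neqAle l2.
  by move=> v w; rewrite lD opprD.
move=> lD l1 _ /inZGP[U [mu uE]] /inZGP[C [mc cE]] uc.
have [a [b g1E]] := mvec_decomp g1; have [a' [b' g2E]] := mvec_decomp g2.
have lB v w : l (v - w) = l v - l w.
  by have := lD (v - w) w; rewrite subrK => ->; rewrite addrK.
have binE (e : bool) x y : tf ('X_[x] - (-1) ^+ e *: 'X_[y]) =
    tf 'X_[x] * (1 - (-1) ^+ e * mono (mvec y - mvec x)).
  rewrite monoB !mono_mvec -pull_out_binomial ?tofracX_neq0 // tofracB; congr (_ - _).
  by case: e; rewrite ?expr0 ?expr1 ?scale1r ?scaleN1r ?mul1r ?mulN1r ?tofracN.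
(* With [u = U / X^mu] and [c = C / X^mc], the extra monomials are what is left after
   cross-multiplying all denominators. *)
have [||| w wZ wE] := @binomial_regular_graded l lD ((-1) ^+ e1) ((-1) ^+ e2)
    a b a' b' (U * 'X_[(mc + a)]) (C * 'X_[(mu + a')]).
- by apply/esym/eqP; rewrite -subr_eq0 -lB -g1E l1.
- by rewrite -subr_gt0 -lB -g2E.
- apply/eqP; rewrite -tofrac_eq !tofracM !binE -g1E -g2E -uE -cE !mpolyXD !tofracM.
  by apply/eqP; apply: cross_binomial.
move: wE; rewrite binE -g1E tofracM -uE => wE.
exists (w * mono (mvec a - mvec mu - mvec (mc + a)%MM)).
  by apply: inZG_M => //; apply: inZG_mono.
apply: (mulIf (tofracX_neq0 mu)); apply: (mulIf (tofracX_neq0 (mc + a)%MM)).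
by rewrite wE !monoB !mono_mvec cancel_two_monomials ?tofracX_neq0.
Qed.

(** * Units of the group ring *)

Definition kill_X (i : 'I_r) : P -> P :=
  comp_mpoly [tuple if j == i then 0 else 'X_j | j < r].

Lemma mpoly_split_X (i : 'I_r) (p : P) : exists p', p = 'X_i * p' + kill_X i p.
Proof.
elim/mpolyind: p => [|c m p _ _ [p' IHp]].
  by exists 0; rewrite /kill_X comp_mpoly0 mulr0 addr0.
suff [q qE] : exists q : P, 'X_[m] = 'X_i * q + kill_X i 'X_[m] :> P.
  exists (c *: q + p'); rewrite /kill_X comp_mpolyD comp_mpolyZ {1}IHp {1}qE.
  by rewrite mulrDr scalerDr -scalerAr; ring.
rewrite /kill_X comp_mpolyX; have [mi0|mi] := posnP (m i).
  exists 0; rewrite mulr0 add0r mpolyXE_id; apply: eq_bigr => j _.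
  by rewrite tnth_mktuple; case: eqP => // ->; rewrite mi0 !expr0.
exists 'X_[(m - U_(i))]; rewrite -mpolyXD addmC submK; last first.
  apply/mnm_lepP => j; rewrite mnm1E; case: eqP => [<-|] //; lia.
rewrite (bigD1 i) //= tnth_mktuple eqxx expr0n.
by rewrite gtn_eqF // mul0r addr0.
Qed.

(** Induction on the degree of the monomial. If [X_i] divides it, setting [X_i = 0] kills the
    product, hence one of the two factors, and [X_i] can be cancelled from that factor. In degree 0
    the factors are units of the polynomial ring, that is 1 or -1. *)
Lemma mpoly_dvd_mono (m : 'X_{1..r}) (p q : P) :
  p * q = 'X_[m] -> exists (s : bool) k, p = (-1) ^+ s *: 'X_[k].
Proof.
have [n] := ubnP (mdeg m); elim: n => // n IHn in m p q *.
have [->|m_neq0] := eqVneq m 0%MM.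
  rewrite mpolyX0 mulrC => _ /mpoly_intro_unit /andP[/eqP pE p0_unit]; rewrite pE.
  have /orP[] : (p@_0%MM == 1) || (p@_0%MM == -1) := p0_unit; move=> /eqP ->; [exists false | exists true]; exists 0%MM.
    by rewrite mpolyX0 expr0 scale1r mpolyC1.
  by rewrite mpolyX0 expr1 scaleN1r mpolyCN mpolyC1.
have [i mi] : exists i, (0 < m i)%N.
  apply/existsP; apply: contraNT m_neq0 => /existsPn m0.
  by apply/eqP/mnmP => i; rewrite mnm0E; have := m0 i; lia.
rewrite ltnS => le_m pq.
have mE : m = (U_(i) + (m - U_(i)))%MM.
  by rewrite addmC submK //; apply/mnm_lepP => j; rewrite mnm1E; case: eqP => [<-|] //; lia.
have lt_m : (mdeg (m - U_(i))%MM < n)%N.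
  by have := congr1 mdeg mE; rewrite mdegD mdeg1; lia.
have X_neq0 : 'X_i != 0 :> P by rewrite -tofrac_eq0 tofracX_neq0.
have := congr1 (kill_X i) pq.
rewrite /kill_X rmorphM /= comp_mpolyX (bigD1 i) //= tnth_mktuple eqxx expr0n gtn_eqF //.
rewrite mul0r => /eqP; rewrite mulf_eq0 => /orP[] /eqP S0.
  have [p' pE] := mpoly_split_X i p; rewrite /kill_X S0 addr0 in pE.
  have /(IHn _ _ _ lt_m)[s [k p'E]] : p' * q = 'X_[(m - U_(i))].
    by apply: (mulfI X_neq0); rewrite mulrA -pE pq -mpolyXD -mE.
  by exists s, (U_(i) + k)%MM; rewrite pE p'E mpolyXD -scalerAr.
have [q' qE] := mpoly_split_X i q; rewrite /kill_X S0 addr0 in qE.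
apply: (IHn _ p q' lt_m).
by apply: (mulfI X_neq0); rewrite mulrCA -qE pq -mpolyXD -mE.
Qed.

Lemma inZG_unit (x y : K) :
  inZG x -> inZG y -> x * y = 1 -> exists (s : bool) g, x = (-1) ^+ s * mono g.
Proof.
move=> /inZGP[p [a xE]] /inZGP[q [b yE]] xy.
have [|s [k pE]] := @mpoly_dvd_mono (a + b)%MM p q.
  apply/eqP; rewrite -tofrac_eq tofracM -xE -yE mpolyXD tofracM.
  by apply/eqP; rewrite mulrACA xy mul1r.
exists s, (mvec k - mvec a); apply: (mulIf (tofracX_neq0 a)).
rewrite monoB !mono_mvec mulrA divfK ?tofracX_neq0 // xE pE.
by case: s {pE}; rewrite ?expr0 ?expr1 ?scale1r ?scaleN1r ?mul1r ?mulN1r ?tofracN.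
Qed.

(** Comparison of coefficients; it guarantees [1 - e g != 0] for a sign [e] and a class [g != 0]. *)
Lemma mono_eq_sign (s : bool) (g : V) : mono g = (-1) ^+ s -> g = 0.
Proof.
have [a [b ->]] := mvec_decomp g; rewrite monoB !mono_mvec.
move/(congr1 (fun x => x * tf 'X_[a])); rewrite divfK ?tofracX_neq0 //.
have -> : (-1) ^+ s * tf 'X_[a] = tf ((-1) ^+ s *: 'X_[a]).
  by case: s; rewrite ?expr0 ?expr1 ?scale1r ?scaleN1r ?mul1r ?mulN1r ?tofracN.
move/eqP; rewrite tofrac_eq => /eqP /(congr1 (mcoeff b)).
rewrite mcoeffZ !mcoeffX eqxx; case: (a =P b) => [-> _|_]; first by rewrite subrr.
by rewrite mulr0.
Qed.

End GroupRing.

Section TrivialUnits.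
Variable r : nat.
Local Notation K := (ZGK r).
Local Notation V := 'rV[int]_r.

Definition trivial_unit (x : K) := exists (s : bool) (g : V), x = (-1) ^+ s * mono g.

Lemma trivial_unit1 : trivial_unit 1.
Proof. by exists false, 0; rewrite mono0 mulr1. Qed.

Lemma trivial_unitM x y : trivial_unit x -> trivial_unit y -> trivial_unit (x * y).
Proof.
move=> [s [g ->]] [s' [g' ->]]; exists (s (+) s'), (g + g').
by rewrite monoD signr_addb mulrACA.
Qed.

Lemma trivial_unitV x : trivial_unit x -> trivial_unit x^-1.
Proof.
move=> [s [g ->]]; exists s, (- g).
by rewrite monoN invfM; congr (_ * _); case: s; rewrite ?expr0 ?expr1 ?invrN ?invr1.
Qed.

Lemma trivial_unitN x : trivial_unit x -> trivial_unit (- x).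
Proof.
by move=> [s [g ->]]; exists (~~ s), g; rewrite signrN mulNr.
Qed.

Lemma trivial_unit_sign (s : bool) : trivial_unit ((-1) ^+ s).
Proof. by exists s, 0; rewrite mono0 mulr1. Qed.

Lemma trivial_unit_mono g : trivial_unit (mono g).
Proof. by exists false, g; rewrite mul1r. Qed.

Lemma trivial_unit_neq0 x : trivial_unit x -> x != 0.
Proof. by move=> [s [g ->]]; rewrite mulf_neq0 ?signr_eq0 ?mono_neq0. Qed.

Lemma trivial_unit_inZG x : trivial_unit x -> inZG x.
Proof. by move=> [s [g ->]]; apply: inZG_M; [apply: inZG_sign | apply: inZG_mono]. Qed.

Lemma trivial_unit_prod (I : finType) (F : I -> K) :
  (forall i, trivial_unit (F i)) -> trivial_unit (\prod_i F i).
Proof.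
by move=> FZ; apply: big_ind => //; [apply: trivial_unit1 | apply: trivial_unitM].
Qed.

End TrivialUnits.

(** * Minors of gain graphs *)

(** A breadth-first tree: [d t] is the distance from [t0], and [p t] is the last vertex but one of a
    shortest path to [t]. *)
Lemma rooted_tree (T : finType) (e : rel T) (t0 : T) :
  (forall t, connect e t0 t) ->
  exists (d : T -> nat) (p : T -> T), forall t, t != t0 -> e (p t) t /\ (d (p t) < d t)%N.
Proof.
move=> e_conn.
pose P t n := [exists s : n.-tuple T, path e t0 s && (last t0 s == t)].
have /fin_all_exists[d dP] t : exists n, P t n /\ forall k, P t k -> (n <= k)%N.
  have exP : exists n, P t n.
    have /connectP[s s_path ->] := e_conn t; exists (size s).
    by apply/existsP; exists (in_tuple s); rewrite s_path /=.
  by case: (ex_minnP exP) => n Pn n_min; exists n.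
have /fin_all_exists[p pP] t : exists t', t != t0 -> e t' t /\ (d t' < d t)%N.
  have [/existsP[[s /= /eqP size_s] /andP[s_path /eqP s_last]] _] := dP t.
  case: (lastP s) => [|s' x] in size_s s_path s_last *.
    by exists t0; rewrite -s_last eqxx.
  exists (last t0 s') => _; rewrite last_rcons in s_last.
  rewrite rcons_path s_last in s_path; case/andP: s_path => s'_path s'_t.
  split=> //; rewrite -size_s size_rcons ltnS; apply: (proj2 (dP _)).
  by apply/existsP; exists (in_tuple s'); rewrite s'_path /=.
by exists d, p.
Qed.

(** Recursion along the parent map with [d t] as fuel; more fuel does not change the value. *)
Lemma tree_rec (T : eqType) (A : Type) (t0 : T) (d : T -> nat) (p : T -> T)
    (a0 : A) (step : T -> A -> A) :
  (forall t, t != t0 -> (d (p t) < d t)%N) ->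
  exists F : T -> A, F t0 = a0 /\ forall t, t != t0 -> F t = step t (F (p t)).
Proof.
move=> dp.
pose rec := fix rec (n : nat) (t : T) {struct n} := if t == t0 then a0 else
                    if n is n'.+1 then step t (rec n' (p t)) else a0.
have recE n : forall t, (d t <= n)%N -> rec n t = rec (d t) t.
  elim/ltn_ind: n => n IHn t le_tn.
  have [->|nt] := eqVneq t t0; first by case: n {IHn le_tn} => [|n]; case: (d t0) => /=; rewrite ?eqxx.
  case: n => [|n] in IHn le_tn *; first by move: le_tn; rewrite leqn0 => /eqP ->.
  have := dp t nt; case dt: (d t) => [|k] //; rewrite ltnS => le_pk.
  rewrite /= (negPf nt); congr (step _ _).
  rewrite IHn //; last by rewrite (leq_trans le_pk) // -ltnS -dt.
  by rewrite [RHS]IHn // -dt.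
exists (fun t => rec (d t) t); split=> [|t nt].
  by case: (d t0) => /=; rewrite ?eqxx.
have := dp t nt; case dt: (d t) => [|k] // lt_k.
by rewrite /= (negPf nt) (recE k).
Qed.

Lemma cancel_potential (F : fieldType) (s1 s2 x y : F) :
  x != 0 -> s1 * s1 = 1 ->
  s2 * y + s1 * x * (- (s1 * s2) * (y / x)) = 0.
Proof.
move=> x_neq0 s11; transitivity (s2 * y * (1 - s1 * s1)); first by field.
by rewrite s11 subrr mulr0.
Qed.

Lemma factor_potential (F : fieldType) (s s1 s2 x y z u : F) :
  x != 0 -> s * s = 1 ->
  (s * x + s1 * z * (s2 * y)) * u = s * x * u * (1 - - (s1 * s2 * s) * (z * y / x)).
Proof.
move=> x_neq0 ss; transitivity ((s * x + (s * s) * s1 * z * (s2 * y)) * u); last by field.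
by rewrite ss; ring.
Qed.

Section GainGraph.
Variables (r : nat) (T F : finType) (up dn : F -> T).
Variables (sg : F -> bool) (om : F -> 'rV[int]_r).
Local Notation K := (ZGK r).
Local Notation V := 'rV[int]_r.

(** Written as a sum so that a loop, with [up f = dn f], gets the entry [1 +- g]. *)
Definition gain_incidence (f : F) (t : T) : K :=
  (t == up f)%:R + (-1) ^+ sg f * mono (om f) * (t == dn f)%:R.

Definition joins (t t' : T) := [exists f, ((up f == t) && (dn f == t')) ||
                                          ((up f == t') && (dn f == t))].

Lemma sum_gain_incidence f (h : T -> K) :
  \sum_t gain_incidence f t * h t =
  h (up f) + (-1) ^+ sg f * mono (om f) * h (dn f).
Proof.
rewrite /gain_incidence (eq_bigr (fun t => (t == up f)%:R * h t +
   (-1) ^+ sg f * mono (om f) * ((t == dn f)%:R * h t))); last by move=> t _; ring.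
rewrite big_split -big_distrr /=; congr (_ + _ * _).
  by rewrite (bigD1 (up f)) //= eqxx mul1r big1 ?addr0 // => t /negPf ->; rewrite mul0r.
by rewrite (bigD1 (dn f)) //= eqxx mul1r big1 ?addr0 // => t /negPf ->; rewrite mul0r.
Qed.

(* The minor on the edges of a spanning tree together with one more edge [f]
   is [1 - gain] of the circuit closed up by [f]; [eta] is the potential that
   kills the gains along the tree. *)
Lemma gain_minors (t0 : T) (f0 : F) :
  (forall t t', connect joins t t') ->
  exists (eta : T -> V) (e : F -> bool), forall f, exists iota : T -> F,
    exists2 u, trivial_unit u & detI (fun t t' => gain_incidence (iota t) t') =
      u * (1 - (-1) ^+ e f * mono (om f + eta (dn f) - eta (up f))).
Proof.
move=> conn; have [d [p dp]] := rooted_tree (conn t0).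
have /fin_all_exists[pf pfP] t : exists f, t != t0 ->
    (up f = t /\ dn f = p t) \/ (dn f = t /\ up f = p t).
  have [->|nt] := eqVneq t t0; first by exists f0.
  have [/existsP[f ff] _] := dp t nt; exists f => _.
  by case/orP: ff => /andP[/eqP <- /eqP <-]; [right | left].
have p_neq t : t != t0 -> p t != t.
  by move=> /dp[_]; apply: contraTneq => ->; rewrite ltnn.
(* Chosen so that the row of the tree edge [pf t] kills [h]: the sign is reversed, and the gain is
   added or subtracted according to the direction in which the edge leads to the parent. *)
pose step t (a : bool * V) := (~~ (sg (pf t) (+) a.1),
  if up (pf t) == t then om (pf t) + a.2 else a.2 - om (pf t)).
have [a [a0 aP]] := tree_rec (false, 0) step (fun t nt => proj2 (dp t nt)).
pose h t := (-1) ^+ (a t).1 * mono (a t).2 : K.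
exists (fun t => (a t).2), (fun f => ~~ (sg f (+) (a (dn f)).1 (+) (a (up f)).1)) => f.
(* A tree edge is indexed by its child, which leaves the index [t0] for [f]. If [f] is itself a tree
   edge, the row is repeated and both sides are 0. *)
pose iota t := if t == t0 then f else pf t; exists iota.
have hpf t : t != t0 -> \sum_j gain_incidence (pf t) j * h j = 0.
  move=> nt; rewrite sum_gain_incidence /h.
  have sgn2 (b : bool) : (-1) ^+ b * (-1) ^+ b = 1 :> K by rewrite -signr_addb addbb.
  case: (pfP t nt) => -[eq1 eq2]; rewrite eq1 eq2 (aP t nt) /= ?eq1 ?eq2 ?eqxx signrN signr_addb.
    by rewrite monoD; ring.
  by rewrite (negPf (p_neq t nt)) monoB cancel_potential ?sgn2 ?mono_neq0.
(* There is a single tree, with root [t0]; every row except that of [f] kills [h]. *)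
rewrite (@detI_forest _ _ (fun=> t0) d h) => //; first last.
- move=> t j; rewrite eq_sym => nt nj; rewrite /iota (negPf nt) leqNgt => lt_j.
  rewrite /gain_incidence; have [_ lt_p] := dp t nt.
  have njp : j != p t by apply: contraNneq lt_j => ->.
  rewrite eq_sym in nj.
  by case: (pfP t nt) => -[-> ->]; rewrite (negPf nj) (negPf njp) mulr0 addr0.
- by move=> t; rewrite eq_sym => nt; rewrite /iota (negPf nt) hpf.
- by move=> t <-; rewrite /h a0 mono0 mulr1.
- by move=> t j; rewrite eqxx.
rewrite (bigD1 t0) //= eqxx {1}/iota eqxx sum_gain_incidence.
pose u := \prod_(t | t != t0) gain_incidence (pf t) t.
exists (h (up f) * u).
  apply: trivial_unitM; first by exists (a (up f)).1, (a (up f)).2.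
  apply: big_ind => [||t nt]; [exact: trivial_unit1 | exact: trivial_unitM |].
  rewrite /gain_incidence; have := p_neq t nt; rewrite eq_sym => /negPf np.
  case: (pfP t nt) => -[-> ->]; rewrite eqxx np ?mulr0 ?mulr1 ?addr0 ?add0r.
    exact: trivial_unit1.
  by exists (sg (pf t)), (om (pf t)).
have -> : \prod_(i | i != t0) (if t0 == i then
     \sum_j gain_incidence (iota i) j * h j else gain_incidence (iota i) i) = u.
  by apply: eq_bigr => t nt; rewrite eq_sym (negPf nt) /iota (negPf nt).
rewrite /h signrN !signr_addb monoB monoD.
have sgn2 (b : bool) : (-1) ^+ b * (-1) ^+ b = 1 :> K by rewrite -signr_addb addbb.
rewrite factor_potential ?sgn2 ?mono_neq0 //.
Qed.
End GainGraph.

(** * Veering combinatorics *)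

Definition inversions (a b c d : nat) : nat :=
  ((b < a) + (c < a) + (d < a) + (c < b) + (d < b) + (d < c))%N.

Lemma even4E (a b c d : 'I_4) : even4 a b c d = ~~ odd (inversions a b c d).
Proof.
rewrite /even4 /=.
under eq_bigr do rewrite big_mkcond /= !big_ord_recl big_ord0 /=.
rewrite !big_ord_recl big_ord0 /= /inversions.
by congr (~~ odd _); rewrite !addn0 !add0n !addnA.
Qed.

(** Transpositions on plain numbers, so that the effect of a transposition on the parity of a
    labelling can be checked by running through all cases. *)
Definition swapn (x y a : nat) : nat := if a == x then y else if a == y then x else a.

Lemma swapn_tperm (x y a : 'I_4) : tperm x y a = swapn x y a :> nat.
Proof.
rewrite /swapn; case: tpermP => [->|->|/eqP nx /eqP ny]; rewrite ?eqxx //.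
  by case: eqP => [/val_inj -> //|_].
by move: nx ny; rewrite -!val_eqE => /negPf -> /negPf ->.
Qed.

Lemma mem_iota4 (a : 'I_4) : (a : nat) \in iota 0 4.
Proof. by rewrite mem_iota /=. Qed.

Lemma uniq4_val (a b c d : 'I_4) :
  uniq [:: a; b; c; d] = uniq [:: (a : nat); (b : nat); (c : nat); (d : nat)].
Proof. by rewrite -(map_inj_uniq val_inj). Qed.

Lemma even4_tperm (a b c d x y : 'I_4) : uniq [:: a; b; c; d] -> x != y ->
  even4 (tperm x y a) (tperm x y b) (tperm x y c) (tperm x y d) = ~~ even4 a b c d.
Proof.
rewrite !even4E !swapn_tperm uniq4_val -val_eqE /= -/(uniq [:: _; _; _; _]).
pose chk a b c d x y := uniq [:: a; b; c; d] ==> (x != y) ==>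
  (~~ odd (inversions (swapn x y a) (swapn x y b) (swapn x y c) (swapn x y d))
     == ~~ ~~ odd (inversions a b c d)).
have chk_all : all (fun a => all (fun b => all (fun c => all (fun d => all (fun x =>
    all (fun y => chk a b c d x y) (iota 0 4)) (iota 0 4)) (iota 0 4)) (iota 0 4))
    (iota 0 4)) (iota 0 4) by vm_compute.
move=> abcd xy.
have := allP (allP (allP (allP (allP (allP chk_all _ (mem_iota4 a)) _ (mem_iota4 b))
  _ (mem_iota4 c)) _ (mem_iota4 d)) _ (mem_iota4 x)) _ (mem_iota4 y).
by rewrite /chk abcd xy /= => /eqP.
Qed.

Lemma uniq4_perm (s : {perm 'I_4}) (a b c d : 'I_4) :
  uniq [:: s a; s b; s c; s d] = uniq [:: a; b; c; d].
Proof. exact: (map_inj_uniq (@perm_inj _ s) [:: a; b; c; d]). Qed.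

Lemma even4_perm (s : {perm 'I_4}) (a b c d : 'I_4) : uniq [:: a; b; c; d] ->
  even4 (s a) (s b) (s c) (s d) = even4 a b c d (+) odd_perm s.
Proof.
have [ts -> ts_d] := prod_tpermP s.
elim: ts a b c d ts_d => [|[x y] ts IHts] a b c d.
  by rewrite !big_nil !perm1 odd_perm1 addbF.
move=> /andP[xy /IHts{}IHts] abcd.
rewrite !big_cons !permM IHts ?uniq4_perm // odd_permM odd_tperm.
have -> := @even4_tperm a b c d x y abcd xy.
by rewrite -[_ != _]/(dpair (x, y)) xy addNb addbN.
Qed.

Lemma ord4_cover (a b c d i : 'I_4) : uniq [:: a; b; c; d] ->
  [|| i == a, i == b, i == c | i == d].
Proof.
move=> abcd; have : i \in [:: a; b; c; d].
  have /subset_cardP/(_ (subset_predT _)) -> // : #|[:: a; b; c; d]| = #|'I_4|.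
  by rewrite (card_uniqP abcd) card_ord.
by rewrite !inE.
Qed.

Lemma uniq4_neq (a b c d : 'I_4) : uniq [:: a; b; c; d] ->
  [/\ a != b, a != c, a != d, b != c & b != d /\ c != d].
Proof.
rewrite /= !inE !negb_or !andbT.
by move=> /and3P[/and3P[-> -> ->] /andP[-> ->] ->].
Qed.

Lemma even4_swap34 (a b c d : 'I_4) : uniq [:: a; b; c; d] ->
  even4 a b d c = ~~ even4 a b c d.
Proof.
move=> abcd; have [ab ac ad bc [bd cd]] := uniq4_neq abcd.
rewrite -(even4_tperm abcd cd) tpermL tpermR !tpermD //; by rewrite eq_sym.
Qed.

Lemma even4_swap12 (a b c d : 'I_4) : uniq [:: a; b; c; d] ->
  even4 b a c d = ~~ even4 a b c d.
Proof.
move=> abcd; have [ab ac ad bc [bd cd]] := uniq4_neq abcd.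
by rewrite -(even4_tperm abcd ab) tpermL tpermR !tpermD.
Qed.

Lemma even4_swap_pairs (a b c d : 'I_4) : uniq [:: a; b; c; d] ->
  even4 c d a b = even4 a b c d.
Proof.
move=> abcd; have [ab ac ad bc [bd cd]] := uniq4_neq abcd.
have := even4_tperm abcd ac; rewrite tpermL tpermR [tperm a c b]tpermD // 1?eq_sym //.
rewrite [tperm a c d]tpermD // => cbad.
have cbad_uniq : uniq [:: c; b; a; d].
  by rewrite /= !inE !negb_or (eq_sym c b) (eq_sym c a) (eq_sym b a) bc ac cd ab bd ad.
have := even4_tperm cbad_uniq bd; rewrite tpermL tpermR !tpermD //; try by rewrite eq_sym.
by rewrite cbad negbK.
Qed.

(** * Labelling a tetrahedron by coorientation and veer *)

Section Labels.
Variable tau : triangulation.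
Hypothesis Htau : veering_triangulation tau.

Local Notation Tet := (@Tet tau).
Local Notation glue := (@glue tau).
Local Notation gperm := (@gperm tau).
Local Notation topf := (@topf tau).
Local Notation Fac := (@Fac tau).
Local Notation face_of := (@face_of tau).
Local Notation Edg := (@Edg tau).
Local Notation edge_of := (@edge_of tau).
Local Notation right_veer := (@right_veer tau).

(* [ab] is the bottom edge and [cd] the top edge: [topf t a] is about the face
   opposite to [a]. *)
Definition flat (t : Tet) (a b c d : 'I_4) : bool :=
  [&& uniq [:: a; b; c; d], topf t a, topf t b, ~~ topf t c & ~~ topf t d].

(* With this labelling, [A] maps the face opposite [d] to the one opposite [b]. *)
Definition label (t : Tet) (a b c d : 'I_4) : bool :=
  flat t a b c d && (right_veer (edge_of t a c) == right_veer (edge_of t c d)).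

Lemma flat_swap12 t a b c d : flat t a b c d -> flat t b a c d.
Proof.
case/and5P=> abcd ta tb tc td; rewrite /flat ta tb tc td !andbT.
move: abcd; rewrite /= !inE !negb_or !andbT eq_sym.
by move=> /and3P[/and3P[-> -> ->] /andP[-> ->] ->].
Qed.

Lemma flat_swap34 t a b c d : flat t a b c d -> flat t a b d c.
Proof.
case/and5P=> abcd ta tb tc td; rewrite /flat ta tb tc td !andbT.
move: abcd; rewrite /= !inE !negb_or !andbT (eq_sym d c).
by move=> /and3P[/and3P[-> -> ->] /andP[-> ->] ->].
Qed.

Lemma flat_neq t a b c d : flat t a b c d ->
  [/\ a != b, a != c, a != d, b != c & b != d /\ c != d].
Proof.
by case/and5P=> /uniq4_neq.
Qed.

Lemma flat_top t a b c d i : flat t a b c d -> topf t i = (i == a) || (i == b).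
Proof.
move=> abcd; have [ab ac ad bc [bd cd]] := flat_neq abcd.
case/and5P: abcd => /(ord4_cover i) + ta tb tc td.
case/or4P=> /eqP ->; rewrite ?ta ?tb ?(negPf tc) ?(negPf td) ?eqxx ?orbT //.
  by rewrite eq_sym (negPf ac) eq_sym (negPf bc).
by rewrite eq_sym (negPf ad) eq_sym (negPf bd).
Qed.

Lemma flat_bot t a b c d i : flat t a b c d -> ~~ topf t i = (i == c) || (i == d).
Proof.
move=> abcd; have [ab ac ad bc [bd cd]] := flat_neq abcd.
case/and5P: abcd => /(ord4_cover i) + ta tb tc td.
case/or4P=> /eqP ->; rewrite ?ta ?tb ?(negPf tc) ?(negPf td) ?eqxx ?orbT //=.
  by rewrite (negPf ac) (negPf ad).
by rewrite (negPf bc) (negPf bd).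
Qed.

Lemma flat_ex t : exists a b c d, flat t a b c d.
Proof.
have c2 := two_top Htau t; have /eqP/cards2P[a [b [ab topE]]] := c2.
have /eqP/cards2P[c [d [cd botE]]] : #|~: [set k | topf t k]| = 2%N.
  by have := cardsC [set k | topf t k]; rewrite c2 card_ord; lia.
have ta : topf t a by have := set21 a b; rewrite -topE inE.
have tb : topf t b by have := set22 a b; rewrite -topE inE.
have tc : ~~ topf t c by have := set21 c d; rewrite -botE !inE.
have td : ~~ topf t d by have := set22 c d; rewrite -botE !inE.
have neq x y : topf t x -> ~~ topf t y -> x != y by move=> tx; apply: contraNneq => <-.
exists a, b, c, d; rewrite /flat ta tb tc td !andbT /= !inE !negb_or.
by rewrite ab cd !neq.
Qed.

Lemma top_count t (a b c d : 'I_4) : uniq [:: a; b; c; d] ->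
  (topf t a + topf t b + topf t c + topf t d = 2)%N.
Proof.
move=> abcd; have := two_top Htau t; rewrite -sum1dep_card big_mkcond /=.
have -> : (\sum_i (if topf t i then 1 else 0))%N = (\sum_i topf t i)%N.
  by apply: eq_bigr => i _; case: topf.
have E : perm_eq [:: a; b; c; d] (index_enum 'I_4).
  apply: uniq_perm => //; first exact: index_enum_uniq.
  by move=> i; rewrite mem_index_enum !inE ord4_cover.
rewrite -(perm_big _ E) !big_cons big_nil /=; lia.
Qed.

(** The veering condition is stated for positively oriented labellings. A negative one becomes
    positive when [c] and [d] are exchanged, and then [ac] is in the place of a left-veering
    side. *)
Lemma flat_veer t a b c d : flat t a b c d ->
  right_veer (edge_of t a c) = even4 a b c d.
Proof.
move=> abcd; have [ab ac ad bc [bd cd]] := flat_neq abcd.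
have /and5P[abcd_uniq ta tb tc td] := abcd.
have [ev|od] := boolP (even4 a b c d).
  by have [] // := @veer _ Htau t a b c d; rewrite ab cd ta tb tc td.
have [|_ /negPf //] := @veer _ Htau t a b d c.
by rewrite ab eq_sym cd ta tb tc td even4_swap34 // od.
Qed.

Lemma flat_veer_ad t a b c d : flat t a b c d ->
  right_veer (edge_of t a d) = ~~ right_veer (edge_of t a c).
Proof.
move=> abcd; rewrite !(flat_veer abcd) (flat_veer (flat_swap34 abcd)) even4_swap34 //.
by case/andP: abcd.
Qed.

Lemma flat_veer_bc t a b c d : flat t a b c d ->
  right_veer (edge_of t b c) = ~~ right_veer (edge_of t a c).
Proof.
move=> abcd; rewrite !(flat_veer abcd) (flat_veer (flat_swap12 abcd)) even4_swap12 //.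
by case/andP: abcd.
Qed.

Lemma flat_veer_bd t a b c d : flat t a b c d ->
  right_veer (edge_of t b d) = right_veer (edge_of t a c).
Proof. by move=> abcd; rewrite (flat_veer_ad (flat_swap12 abcd)) (flat_veer_bc abcd) negbK. Qed.

Lemma label_flat t a b c d : label t a b c d -> flat t a b c d.
Proof. by case/andP. Qed.

Lemma label_swap t a b c d : label t a b c d -> label t b a d c.
Proof.
case/andP=> abcd ac; rewrite /label (flat_swap12 (flat_swap34 abcd)) /=.
by rewrite (flat_veer_bd abcd) (edge_of_sym Htau t d c).
Qed.

Lemma label_ex t : exists a b c d, label t a b c d.
Proof.
have [a [b [c [d abcd]]]] := flat_ex t.
have [ac|nac] := eqVneq (right_veer (edge_of t a c)) (right_veer (edge_of t c d)).
  by exists a, b, c, d; rewrite /label abcd ac eqxx.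
exists b, a, c, d; rewrite /label flat_swap12 //= (flat_veer_bc abcd).
by move: nac; case: right_veer; case: right_veer.
Qed.

Lemma label_bot_ex t k : ~~ topf t k -> exists a b c, label t a b c k.
Proof.
have [a [b [c [d abcd]]]] := label_ex t.
rewrite (flat_bot k (label_flat abcd)) => /orP[] /eqP ->; last by exists a, b, c.
by exists b, a, d; apply: label_swap.
Qed.

(** The two slots of a face have opposite coorientations, so the coorientation selects one. *)
Lemma face_inj t k t' k' : topf t k = topf t' k' ->
  face_of (t, k) = face_of (t', k') -> t = t' /\ k = k'.
Proof.
move=> tk /(face_of_fiber Htau) [[-> ->] //|E].
by have := coorient Htau (t, k); rewrite -E /= tk eqxx.
Qed.

Lemma glue_edge t k i j : i != j -> k != i -> k != j ->
  edge_of t i j = edge_of (glue (t, k)).1 (gperm (t, k) i) (gperm (t, k) j).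
Proof.
move=> ij ki kj; apply/(edge_of_fiber Htau) => //; first by rewrite (inj_eq perm_inj).
left; apply: connect1; rewrite /edge_step ij; apply/existsP; exists k.
by rewrite ki kj !eqxx.
Qed.

Lemma glue_top t k : topf (glue (t, k)).1 (gperm (t, k) k) = ~~ topf t k.
Proof.
have := coorient Htau (t, k); rewrite -(gperm_face Htau) /=.
by case: topf; case: topf.
Qed.

Lemma glue_face t k : face_of ((glue (t, k)).1, gperm (t, k) k) = face_of (t, k).
Proof.
apply/(face_of_fiber Htau); right.
have := gperm_face Htau (t, k); rewrite /= => ->; rewrite -surjective_pairing.
by rewrite (glue_invol Htau).
Qed.

Lemma face_label f : exists t a b c d, label t a b c d /\ f = face_of (t, d).
Proof.
have [[t k] <-] := face_of_surj Htau f.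
wlog tk : t k / ~~ topf t k.
  move=> IH; have [tk|] := boolP (topf t k); last exact: IH.
  have [|t' E] := IH (glue (t, k)).1 (gperm (t, k) k).
    by rewrite glue_top tk.
  by rewrite glue_face in E; exists t'.
have [a [b [c abck]]] := label_bot_ex tk.
by exists t, a, b, c, k.
Qed.

(* Crossing the top face [acd] upwards, the edge [ac] becomes the bottom edge. *)
Lemma label_above t a b c d : label t a b c d ->
  flat (glue (t, b)).1 (gperm (t, b) a) (gperm (t, b) c) (gperm (t, b) d) (gperm (t, b) b).
Proof.
case/andP=> abcd /eqP ac_cd; have [ab ac ad bc [bd cd]] := flat_neq abcd.
have /and5P[abcd_uniq ta tb tc td] := abcd.
set t' := (glue (t, b)).1; set s := gperm (t, b).
have s_uniq x y z w : uniq [:: x; y; z; w] -> uniq [:: s x; s y; s z; s w].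
  by rewrite uniq4_perm.
have ba : b != a by rewrite eq_sym.
have nsb : ~~ topf t' (s b) by rewrite /t' /s glue_top tb.
have := top_count t' (s_uniq _ _ _ _ abcd_uniq); rewrite (negPf nsb).
have edge i j : i != j -> b != i -> b != j -> edge_of t' (s i) (s j) = edge_of t i j.
  by move=> *; rewrite -glue_edge.
have acdb : uniq [:: a; c; d; b].
  by rewrite /= !inE !negb_or ac ad ab cd (eq_sym c) bc eq_sym bd.
(* The bottom edge of [t'] is one of the three edges of the face [acd]; those through [d] have to be
   excluded. *)
have [sd|sd] := boolP (topf t' (s d)); last first.
  rewrite /flat s_uniq // nsb sd !andbT.
  by case: topf; case: topf.
have [sc|sc] := boolP (topf t' (s c)); last first.
  case sa: (topf t' (s a)) => // _.
  (* With bottom edge [ad], the edges [ac] and [dc] are sides of [t'] meeting at an end of its top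
     edge, so their veers differ; in [t] they agree by the choice of label. *)
  have fl : flat t' (s a) (s d) (s c) (s b).
    rewrite /flat sa sd sc nsb !andbT; apply: s_uniq.
    by rewrite /= !inE !negb_or ad ac ab (eq_sym d) cd (eq_sym d) bd eq_sym bc.
  have := flat_veer_bc fl; rewrite (edge d c) ?(edge a c) // 1?eq_sym //.
  rewrite (edge_of_sym Htau t d) ac_cd.
  by case: right_veer.
case sa: (topf t' (s a)) => // _.
(* With bottom edge [cd], the edge [ac] is a side in both tetrahedra and its veer is given by the
   orientation in each; the gluing reverses orientation, a contradiction. *)
have fl : flat t' (s c) (s d) (s a) (s b).
  rewrite /flat sa sd sc nsb !andbT; apply: s_uniq.
  by rewrite /= !inE !negb_or cd (eq_sym c a) ac (eq_sym c b) bc (eq_sym d a) ad (eq_sym d b) bd ab.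
have cdab : uniq [:: c; d; a; b].
  by rewrite /= !inE !negb_or cd (eq_sym c a) ac (eq_sym c b) bc (eq_sym d a) ad (eq_sym d b) bd ab.
have := flat_veer fl; rewrite (edge c a) // 1?eq_sym // (edge_of_sym Htau t c) (flat_veer abcd).
rewrite even4_perm // even4_swap_pairs // (gperm_odd Htau).
by case: even4.
Qed.

End Labels.

(** * Angles around an edge *)

Lemma ord4_complete (i j : 'I_4) : i != j -> exists k l, uniq [:: i; j; k; l].
Proof.
move=> ij; have /eqP/cards2P[k [l [kl E]]] : #|~: [set i; j]| = 2%N.
  by have := cardsC [set i; j]; rewrite cards2 ij card_ord; lia.
have : k \notin [set i; j] by have := set21 k l; rewrite -E inE.
have : l \notin [set i; j] by have := set22 k l; rewrite -E inE.
rewrite !inE !negb_or !(eq_sym l) !(eq_sym k i) !(eq_sym k j) => /andP[il jl] /andP[ik jk].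
by exists k, l; rewrite /= !inE !negb_or ij ik il jk jl kl.
Qed.

Section Edges.
Variable tau : triangulation.
Hypothesis Htau : veering_triangulation tau.

Local Notation Tet := (@Tet tau).
Local Notation glue := (@glue tau).
Local Notation gperm := (@gperm tau).
Local Notation topf := (@topf tau).
Local Notation Fac := (@Fac tau).
Local Notation face_of := (@face_of tau).
Local Notation Edg := (@Edg tau).
Local Notation edge_of := (@edge_of tau).
Local Notation right_veer := (@right_veer tau).

Definition flag := (Tet * 'I_4 * 'I_4 * 'I_4 * 'I_4)%type.

(* Turning around the edge [ij]: leave the tetrahedron through the face
   opposite [k], enter the next one through the face opposite the last vertex. *)
Definition turn (x : flag) : flag :=
  let: (t, i, j, k, l) := x in
  ((glue (t, k)).1, gperm (t, k) i, gperm (t, k) j, gperm (t, k) l, gperm (t, k) k).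

Lemma turn_inj : injective turn.
Proof.
move=> [[[[t i] j] k] l] [[[[t' i'] j'] k'] l'] [tt' ii' jj' ll' kk'].
have E : glue (t, k) = glue (t', k').
  rewrite [LHS]surjective_pairing [RHS]surjective_pairing tt'.
  by rewrite -!(gperm_face Htau) /= kk'.
have [tE kE] : (t, k) = (t', k') by rewrite -(glue_invol Htau (t, k)) E (glue_invol Htau).
rewrite -tE -kE in ii' jj' ll' *.
by rewrite (perm_inj ii') (perm_inj jj') (perm_inj ll').
Qed.

Lemma pi_slot_ex (e : Edg) : exists t i j,
  [/\ i != j, edge_of t i j = e & topf t i = topf t j].
Proof.
have : (0 < #|[set x : oslot tau | [&& (x.1.2 < x.2)%N,
    edge_of x.1.1 x.1.2 x.2 == e & pi_angle x.1.1 x.1.2 x.2]]|)%N.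
  by rewrite (angle_sum Htau e).
case/card_gt0P => [[[t i] j]]; rewrite inE /= => /and3P[lt_ij /eqP ijE /eqP ij].
by exists t, i, j; split=> //; apply: contraTneq lt_ij => ->; rewrite ltnn.
Qed.

(* Turning around the edge in a constant vertical direction, one must meet
   the other kind of angle-pi slot before coming back to the start. *)
Lemma pi_slot_of_kind (beta : bool) (e : Edg) : exists t i j,
  [/\ i != j, edge_of t i j = e, topf t i = beta & topf t j = beta].
Proof.
pose kind t i j := [&& i != j, edge_of t i j == e, topf t i == beta & topf t j == beta].
suff /existsP[t /existsP[i /existsP[j /and4P[ij /eqP ijE /eqP ti /eqP tj]]]] :
    [exists t, exists i, exists j, kind t i j] by exists t, i, j.
apply: contraT => nokind.
have {}nokind t i j : ~~ kind t i j.
  by apply: contraNN nokind => ?; apply/existsP; exists t; apply/existsP; exists i;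
     apply/existsP; exists j.
have [t [i [j [ij ijE tij]]]] := pi_slot_ex e.
have tj : topf t j = ~~ beta.
  by have := nokind t i j; rewrite /kind ij ijE tij eqxx andbb; case: topf; case: beta {nokind kind}.
have ti : topf t i = ~~ beta by rewrite tij.
have [k [l [ijkl tk tl]]] : exists k l, [/\ uniq [:: i; j; k; l], topf t k = beta & topf t l = beta].
  have [k [l ijkl]] := ord4_complete ij; exists k, l.
  have := top_count Htau t ijkl; rewrite ti tj.
  by case: beta {ti tj tij kind nokind}; do 2 case: topf.
pose x0 : flag := (t, i, j, k, l).
(* After a turn the face of entry, opposite [l], has kind [~~ beta]. Since [i] and [j] are not both
   of kind [beta], two faces of each kind force [beta] on the next exit face. The period of [turn]
   gives the contradiction: back at [x0] the last vertex has kind [beta]. *)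
have inv n : let: (t, i, j, k, l) := iter n turn x0 in
    [/\ uniq [:: i; j; k; l], edge_of t i j = e, topf t k = beta & (n > 0)%N -> topf t l = ~~ beta].
  elim: n => [|n] /=; first by split.
  case: (iter n turn x0) => [[[[t1 i1] j1] k1] l1] [u1 e1 tk1 _] /=.
  have [ij1 ik1 il1 jk1 [jl1 kl1]] := uniq4_neq u1.
  have eE : edge_of (glue (t1, k1)).1 (gperm (t1, k1) i1) (gperm (t1, k1) j1) = e.
    by rewrite -(glue_edge Htau) // 1?eq_sym // eq_sym.
  have tkE : topf (glue (t1, k1)).1 (gperm (t1, k1) k1) = ~~ beta by rewrite (glue_top Htau) tk1.
  have u2 : uniq [:: gperm (t1, k1) i1; gperm (t1, k1) j1; gperm (t1, k1) l1; gperm (t1, k1) k1].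
    by rewrite uniq4_perm /= !inE !negb_or ij1 il1 ik1 jl1 jk1 eq_sym kl1.
  split=> //; have := top_count Htau (glue (t1, k1)).1 u2; rewrite tkE.
  have := nokind (glue (t1, k1)).1 (gperm (t1, k1) i1) (gperm (t1, k1) j1).
  rewrite /kind eE eqxx (inj_eq perm_inj) ij1 /=.
  by case: (beta); do 3 case: topf.
have := inv (fingraph.order turn x0); rewrite (iter_order turn_inj) /x0.
by move=> [_ _ _ /(_ (fingraph.order_gt0 _ _))]; rewrite tl; case: (beta).
Qed.

(** The angle sum counts an edge of a tetrahedron once, with its vertices in increasing order. *)
Definition sorted_slot (t : Tet) (i j : 'I_4) : oslot tau :=
  if (i < j)%N then (t, i, j) else (t, j, i).

(** One of the two angles pi at an edge belongs to a tetrahedron having it as top edge, which leaves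
    a single one for a bottom edge. *)
Lemma bottom_slot_uniq t i j t' i' j' : i != j -> i' != j' ->
  topf t i -> topf t j -> topf t' i' -> topf t' j' ->
  edge_of t i j = edge_of t' i' j' -> t = t'.
Proof.
move=> ij ij' ti tj ti' tj' E.
have [t2 [k [l [kl klE tk tl]]]] := pi_slot_of_kind false (edge_of t i j).
pose S := [set x : oslot tau | [&& (x.1.2 < x.2)%N,
    edge_of x.1.1 x.1.2 x.2 == edge_of t i j & pi_angle x.1.1 x.1.2 x.2]].
have inS u x y : x != y -> edge_of u x y = edge_of t i j -> topf u x = topf u y ->
    sorted_slot u x y \in S.
  move=> xy xyE uxy; rewrite inE /sorted_slot.
  case: (ltnP x y) => [lt_xy|le_yx]; first by rewrite /= lt_xy /pi_angle uxy xyE !eqxx.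
  rewrite /= /pi_angle uxy (edge_of_sym Htau u y) xyE !eqxx !andbT.
  by rewrite ltn_neqAle le_yx andbT eq_sym; apply: contraNneq xy => /val_inj ->.
have slot1 u x y : (sorted_slot u x y).1.1 = u by rewrite /sorted_slot; case: ifP.
have slot_top u x y : topf u x = topf u y -> topf u (sorted_slot u x y).2 = topf u x.
  by move=> uxy; rewrite /sorted_slot; case: ifP.
apply/eqP; apply: contraT => tt'.
have sub : [:: sorted_slot t i j; sorted_slot t' i' j'; sorted_slot t2 k l] \subset S.
  apply/subsetP => x; rewrite !inE => /or3P[] /eqP ->.
  - by have := inS t i j ij erefl; rewrite ti tj inE => ->.
  - by have := inS t' i' j' ij' (esym E); rewrite ti' tj' inE => ->.
  - by have := inS t2 k l kl klE; rewrite tk tl inE => ->.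
have := subset_leq_card sub; rewrite (angle_sum Htau).
rewrite (card_uniqP _) //= !inE !negb_or !andbT.
have neq u x y u' x' y' : u != u' -> sorted_slot u x y != sorted_slot u' x' y'.
  by apply: contraNneq => /(congr1 (fun x => x.1.1)); rewrite !slot1 => ->.
have neq2 u x y : topf u x -> topf u y -> sorted_slot u x y != sorted_slot t2 k l.
  move=> ux uy; have [ut|ut] := eqVneq u t2; last exact: neq.
  apply/eqP => eq_s; have := slot_top u x y; rewrite ux uy => /(_ erefl).
  by rewrite eq_s {1}ut slot_top tk ?tl.
by rewrite neq // !neq2.
Qed.

Section Labelling.
Variables va vb vc vd : Tet -> 'I_4.
Hypothesis lab : forall t, label t (va t) (vb t) (vc t) (vd t).

Definition bot_edge t := edge_of t (va t) (vb t).

Lemma bot_edge_bij : bijective bot_edge.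
Proof.
have flab t := label_flat (lab t).
have bot_inj : injective bot_edge.
  move=> t t' E; have [ab _ _ _ _] := flat_neq (flab t).
  have [ab' _ _ _ _] := flat_neq (flab t').
  have /and5P[_ ta tb _ _] := flab t; have /and5P[_ ta' tb' _ _] := flab t'.
  exact: (bottom_slot_uniq ab ab').
apply: (inj_card_bij bot_inj).
have sur e : exists t, bot_edge t = e.
  have [t [i [j [ij <- ti tj]]]] := pi_slot_of_kind true e; exists t.
  move: ti tj ij; rewrite (flat_top _ (flab t)) (flat_top j (flab t)) /bot_edge.
  move=> /orP[] /eqP -> /orP[] /eqP ->; rewrite ?eqxx // => _.
  exact: edge_of_sym.
have /fin_all_exists[g gK] := sur.
by apply: (leq_card g); apply: can_inj gK.
Qed.

End Labelling.
End Edges.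

(** * The matrices of the polynomials *)

Lemma sum_only (I : finType) (M : nmodType) (F : I -> M) (i0 : I) :
  (forall i, i != i0 -> F i = 0) -> \sum_i F i = F i0.
Proof. by move=> F0; rewrite (bigD1 i0) //= big1 ?addr0. Qed.

(** Collapses the sums over vertex pairs in the matrices: a single unordered pair survives, and the
    symmetry of [G] makes it irrelevant which vertex has the smaller number. *)
Lemma sum_ordered_pairs (M : nmodType) n (P : pred 'I_n) (x y : 'I_n)
    (G : 'I_n -> 'I_n -> M) :
  x != y -> (forall i, P i = (i == x) || (i == y)) -> G x y = G y x ->
  \sum_(a < n) \sum_(b < n) (if [&& (a < b)%N, P a & P b] then G a b else 0) = G x y.
Proof.
wlog lt_xy : x y / (x < y)%N.
  move=> IH xy PE Gxy; have [|le_yx] := ltnP x y; first by move/IH; apply.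
  rewrite Gxy; apply: IH => //; last by move=> i; rewrite PE orbC.
    by rewrite ltn_neqAle le_yx andbT eq_sym; apply: contraNneq xy => /val_inj ->.
  by rewrite eq_sym.
move=> xy PE _; rewrite (@sum_only _ _ _ x) => [|a ax].
  rewrite (@sum_only _ _ _ y) => [|b yb]; first by rewrite !PE lt_xy !eqxx orbT.
  by rewrite !PE (negPf yb) orbF; case: (b =P x) => [->|]; rewrite ?ltnn ?andbF.
rewrite big1 // => b _; rewrite !PE (negPf ax) /=.
case: (a =P y) => [->|]; last by rewrite andbF.
case: (b =P x) => [->|_]; first by rewrite ltnNge ltnW.
by case: (b =P y) => [->|_]; rewrite ?ltnn ?andbF.
Qed.

Lemma lmat_arith (F : fieldType) (e1 e2 e3 e4 x1 x2 x3 x4 : F) : x1 != 0 ->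
  e1 - (e2 * (x2 / x1) + (0 + (e3 * (x3 / x1) + (e4 * (x4 / x1) + (0 + 0))))) =
  x1^-1 * (e1 * x1 - e2 * x2 - e3 * x3 - e4 * x4).
Proof. by move=> x1_neq0; field. Qed.

Section Matrices.
Variable tau : triangulation.
Hypothesis Htau : veering_triangulation tau.

Local Notation Tet := (@Tet tau).
Local Notation glue := (@glue tau).
Local Notation gperm := (@gperm tau).
Local Notation topf := (@topf tau).
Local Notation Fac := (@Fac tau).
Local Notation face_of := (@face_of tau).
Local Notation Edg := (@Edg tau).
Local Notation edge_of := (@edge_of tau).
Local Notation right_veer := (@right_veer tau).

Variables (r : nat) (om : Fac -> 'rV[int]_r).
Variables (lam : Tet -> 'I_4 -> 'I_4 -> 'rV[int]_r).
Hypothesis Hlam : lift_rule om lam.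
Variable nu : Fac -> 'rV[int]_r.

Lemma lam_sym t i j : lam t i j = lam t j i.
Proof. by case: Hlam => ->. Qed.

(* the lift of the edge [ij] of the base copy of [t], as a column of [Z[G]^E] *)
Definition edge_lift (e : Edg) (t : Tet) (i j : 'I_4) : ZGK r :=
  (edge_of t i j == e)%:R * mono (lam t i j).

Lemma LDmat_bottom e t a b c d : flat t a b c d ->
  LDmat lam nu e (face_of (t, d)) =
  mono (nu (face_of (t, d))) *
    (edge_lift e t a b - edge_lift e t a c - edge_lift e t b c).
Proof.
move=> abcd; have [ab ac ad bc [bd cd]] := flat_neq abcd.
have /and5P[_ ta tb tc td] := abcd.
have only t' k : face_of (t', k) = face_of (t, d) -> ~~ topf t' k -> t' = t /\ k = d.
  by move=> fE tk; apply: (face_inj Htau) fE; rewrite (negPf tk) (negPf td).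
rewrite /LDmat (@sum_only _ _ _ t) => [|t' nt]; last first.
  do 4 (apply: big1 => ? _); case: ifP => // /and3P[/eqP fE tk _].
  by have [tE _] := only _ _ fE tk; rewrite tE eqxx in nt.
rewrite (@sum_only _ _ _ d) => [|k nk]; last first.
  do 3 (apply: big1 => ? _); case: ifP => // /and3P[/eqP fE tk _].
  by have [_ kE] := only _ _ fE tk; rewrite kE eqxx in nk.
rewrite (@sum_only _ _ _ c) => [|l nl]; last first.
  do 2 (apply: big1 => ? _); case: ifP => // /and5P[_ _ tl ld _].
  by move: tl; rewrite (flat_bot l abcd) (negPf nl) (negPf ld).
rewrite eqxx td tc cd /=.
rewrite (@sum_ordered_pairs _ _ (topf t) a b) //.
- by rewrite /edge_lift !monoD; ring.
- by move=> i; rewrite (flat_top i abcd).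
rewrite (edge_of_sym Htau t a b) (lam_sym t a b); ring.
Qed.

(** The face is read from the tetrahedron above, where [ac] is the bottom edge, and its edges are
    carried back by the lift rule; this produces the shift by [om]. *)
Lemma LDmat_top e t a b c d : label t a b c d ->
  LDmat lam nu e (face_of (t, b)) =
  mono (nu (face_of (t, b)) - om (face_of (t, b))) *
    (edge_lift e t a c - edge_lift e t a d - edge_lift e t c d).
Proof.
move=> abcd; have [ab ac ad bc [bd cd]] := flat_neq (label_flat abcd).
have /and5P[_ ta tb tc td] := label_flat abcd.
have up := label_above Htau abcd.
rewrite -(glue_face Htau t b) (LDmat_bottom e up) (glue_face Htau).
set t' := (glue (t, b)).1; set s := gperm (t, b).
have lift i j : i != j -> b != i -> b != j ->
    edge_lift e t i j = mono (om (face_of (t, b))) * edge_lift e t' (s i) (s j).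
  move=> ij bi bj; rewrite /edge_lift (glue_edge Htau t ij bi bj).
  by case: Hlam => _ /(_ t b i j tb ij bi bj) ->; rewrite monoD mulrCA.
rewrite !lift // 1?eq_sym // monoB -!mulrBr mulrA divfK ?mono_neq0 //.
Qed.

(** A label singles out the one tuple that contributes to the sums defining [Amat]. *)
Lemma ABcondE t a b c d f' t' k l v w : label t a b c d ->
  ABcond (face_of (t, d)) f' t' k l v w =
  [&& t' == t, k == d, l == c, v == a, w == b & face_of (t, b) == f'].
Proof.
move=> abcd; have [ab ac ad bc [bd cd]] := flat_neq (label_flat abcd).
have /and5P[_ ta tb tc td] := label_flat abcd.
have fl := label_flat abcd; have /andP[_ /eqP veer_ac] := abcd.
apply/idP/idP; last first.
  case/and5P=> /eqP -> /eqP -> /eqP -> /eqP -> /andP[/eqP -> fE].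
  by rewrite /ABcond eqxx td tc cd ta tb eq_sym ab fE andbT (edge_of_sym Htau t d c) veer_ac eqxx.
case/and5P=> /eqP fE tk tl lk /and5P[tv tw wv veq fE'].
have [tE kE] : t' = t /\ k = d by apply: (face_inj Htau) fE; rewrite (negPf tk) (negPf td).
subst t' k.
have lE : l = c by move: tl; rewrite (flat_bot l fl) (negPf lk) orbF => /eqP.
subst l.
have vE : v = a.
  move: tv; rewrite (flat_top v fl) => /orP[/eqP //|/eqP vb].
  by move: veq; rewrite vb (flat_veer_bc Htau fl) veer_ac (edge_of_sym Htau t d c); case: right_veer.
subst v.
have wE : w = b by move: tw; rewrite (flat_top w fl) (negPf wv) => /eqP.
by subst w; rewrite !eqxx.
Qed.

Lemma Amat_label f' t a b c d : label t a b c d ->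
  Amat om nu f' (face_of (t, d)) =
  (face_of (t, b) == f')%:R * mono (nu (face_of (t, d)) + om f' - nu f').
Proof.
move=> abcd; rewrite /Amat.
rewrite (@sum_only _ _ _ t) => [|t' nt]; last first.
  by do 4 (apply: big1 => ? _); rewrite (ABcondE _ _ _ _ _ _ abcd) (negPf nt).
rewrite (@sum_only _ _ _ d) => [|k nk]; last first.
  by do 3 (apply: big1 => ? _); rewrite (ABcondE _ _ _ _ _ _ abcd) (negPf nk) andbF.
rewrite (@sum_only _ _ _ c) => [|l nl]; last first.
  by do 2 (apply: big1 => ? _); rewrite (ABcondE _ _ _ _ _ _ abcd) (negPf nl) !andbF.
rewrite (@sum_only _ _ _ a) => [|v nv]; last first.
  by apply: big1 => ? _; rewrite (ABcondE _ _ _ _ _ _ abcd) (negPf nv) !andbF.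
rewrite (@sum_only _ _ _ b) => [|w nw]; last first.
  by rewrite (ABcondE _ _ _ _ _ _ abcd) (negPf nw) !andbF.
by rewrite (ABcondE _ _ _ _ _ _ abcd) !eqxx /=; case: eqP; rewrite ?mul1r ?mul0r.
Qed.

Lemma Aperm_label t a b c d : label t a b c d ->
  Aperm (face_of (t, d)) = face_of (t, b).
Proof.
move=> abcd; rewrite /Aperm; case: pickP => [f'|no].
  case/existsP=> t' /existsP[k] /existsP[l] /existsP[v] /existsP[w].
  by rewrite (ABcondE _ _ _ _ _ _ abcd) => /and5P[_ _ _ _ /andP[_ /eqP]].
have := no (face_of (t, b)); rewrite /ABrel => /existsP[]; exists t.
apply/existsP; exists d; apply/existsP; exists c; apply/existsP; exists a.
by apply/existsP; exists b; rewrite (ABcondE _ _ _ _ _ _ abcd) !eqxx.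
Qed.

(** No other tetrahedron has this bottom edge. In a label the sides [ac] and [bd] share the veer of
    [cd], so the two sides that enter are [ad] and [bc]. *)
Lemma Lmat_label e t a b c d : label t a b c d ->
  Lmat lam e (edge_of t a b) =
  mono (- lam t a b) *
   (edge_lift e t a b - edge_lift e t c d - edge_lift e t a d - edge_lift e t b c).
Proof.
move=> abcd; have [ab ac ad bc [bd cd]] := flat_neq (label_flat abcd).
have /and5P[_ ta tb tc td] := label_flat abcd.
have fl := label_flat abcd; have /andP[_ /eqP veer_ac] := abcd.
rewrite /Lmat (@sum_only _ _ _ t) => [|t' nt]; last first.
  apply: big1 => a' _; apply: big1 => b' _; apply: big1 => c' _; apply: big1 => d' _.
  case: ifP => // /and5P[lt_ab _ ta' tb' /and3P[_ _ /eqP abE]].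
  have ab' : a' != b' by apply: contraTneq lt_ab => ->; rewrite ltnn.
  by rewrite (bottom_slot_uniq Htau ab' ab ta' tb' ta tb abE) eqxx in nt.
pose G a b c d := (edge_of t c d == e)%:R * mono (lam t c d - lam t a b) +
  \sum_(uv <- [:: (a, c); (a, d); (b, c); (b, d)])
    (if (right_veer (edge_of t uv.1 uv.2) != right_veer (edge_of t c d))
        && (edge_of t uv.1 uv.2 == e)
     then mono (lam t uv.1 uv.2 - lam t a b) else 0) : ZGK r.
have Gcd a' b' : G a' b' c d = G a' b' d c.
  rewrite /G (edge_of_sym Htau t d c) (lam_sym t d c); congr (_ + _).
  by rewrite !big_cons !big_nil !addr0 addrCA; congr (_ + (_ + _)); rewrite addrC.
have Gab c' d' : G a b c' d' = G b a c' d'.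
  rewrite /G (lam_sym t b a); congr (_ + _).
  by rewrite !big_cons !big_nil !addr0 addrA addrC -addrA.
transitivity ((e == edge_of t a b)%:R - \sum_(a' < 4) \sum_(b' < 4)
    if [&& (a' < b')%N, topf t a' & topf t b'] then G a' b' c d else 0).
  congr (_ - _); apply: eq_bigr => a' _; apply: eq_bigr => b' _.
  case: ifP => [/and3P[lt_ab ta' tb']|nab]; last first.
    apply: big1 => c' _; apply: big1 => d' _; case: ifP => // /and5P[lt_ab _ ta' tb' _].
    by rewrite lt_ab ta' tb' in nab.
  rewrite -(@sum_ordered_pairs _ _ (fun i => ~~ topf t i) c d (G a' b')) //; last first.
    by move=> i; rewrite (flat_bot i fl).
  apply: eq_bigr => c' _; apply: eq_bigr => d' _; rewrite lt_ab ta' tb' /=.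
  suff -> : edge_of t a' b' == edge_of t a b by rewrite andbT.
  move: ta' tb' lt_ab; rewrite (flat_top _ fl) (flat_top b' fl).
  move=> /orP[] /eqP -> /orP[] /eqP ->; rewrite ?ltnn // => _.
  by rewrite (edge_of_sym Htau).
rewrite (@sum_ordered_pairs _ _ (topf t) a b (fun a' b' => G a' b' c d)) //; last first.
  by move=> i; rewrite (flat_top i fl).
rewrite /G !big_cons big_nil /= -veer_ac.
rewrite (flat_veer_ad Htau fl) (flat_veer_bc Htau fl) (flat_veer_bd Htau fl) eqxx /=.
have -> : (~~ right_veer (edge_of t a c) != right_veer (edge_of t a c)) = true.
  by case: right_veer.
have ifE (P : bool) x : (if P then x else 0) = P%:R * x :> ZGK r.
  by case: P; rewrite ?mul1r ?mul0r.
rewrite /= !ifE /edge_lift !monoB monoN eq_sym lmat_arith ?mono_neq0 //.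
Qed.

End Matrices.

(** * The relation between the three matrices and its minors *)

Definition sum_fun (A B F : Type) (i : A -> F) (j : B -> F) (x : A + B) : F :=
  match x with inl a => i a | inr b => j b end.

Lemma complement_fun (A B F : finType) (i : A -> F) :
  injective i -> #|F| = (#|A| + #|B|)%N ->
  exists j : B -> F, bijective (sum_fun i j).
Proof.
move=> i_inj cardF; pose C := ~: [set i a | a in A].
have cardC : #|B| = #|C|.
  by apply: (@addnI #|A|); rewrite -cardF -(cardsC [set i a | a in A]) card_imset.
pose j b : F := enum_val (cast_ord cardC (enum_rank b)).
have jC b : j b \in C by apply: enum_valP.
have ij a b : i a != j b.
  by apply: contraTneq (jC b) => <-; rewrite inE negbK imset_f.
exists j; apply: inj_card_bij; last by rewrite card_sum cardF.
move=> [a|b] [a'|b'] /= E; first by rewrite (i_inj _ _ E).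
- by have := ij a b'; rewrite E eqxx.
- by have := ij a' b; rewrite E eqxx.
by move: E => /enum_val_inj/cast_ord_inj/enum_rank_inj ->.
Qed.

Lemma sum_delta_l (R : pzSemiRingType) (I : finType) (i : I) (F : I -> R) :
  \sum_j (i == j)%:R * F j = F i.
Proof.
rewrite (bigD1 i) //= eqxx mul1r big1 ?addr0 // => j.
by rewrite eq_sym => /negPf ->; rewrite mul0r.
Qed.

Lemma relation_arith (F : fieldType) (n nf o l ab ac bc ad cd : F) :
  nf != 0 -> o != 0 -> l != 0 ->
  n * (ab - ac - bc) + nf / o * (ac - ad - cd) * (n * o / nf) =
  n * l * (l^-1 * (ab - cd - ad - bc)).
Proof. by move=> nf0 o0 l0; field; rewrite nf0 o0 l0. Qed.

Lemma column_arith (F : fieldType) (n1 nf o d1 d2 : F) :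
  n1 != 0 -> nf != 0 ->
  d1 * nf^-1 + d2 * (n1 * o / nf) * n1^-1 = nf^-1 * (d1 + d2 * o).
Proof. by move=> n10 nf0; field; rewrite nf0 n10. Qed.

Section Relation.
Variable tau : triangulation.
Hypothesis Htau : veering_triangulation tau.

Local Notation Tet := (@Tet tau).
Local Notation glue := (@glue tau).
Local Notation topf := (@topf tau).
Local Notation Fac := (@Fac tau).
Local Notation face_of := (@face_of tau).
Local Notation Edg := (@Edg tau).
Local Notation edge_of := (@edge_of tau).

Variables (r : nat) (om : Fac -> 'rV[int]_r).
Variables (lam : Tet -> 'I_4 -> 'I_4 -> 'rV[int]_r).
Hypothesis Hlam : lift_rule om lam.
Variable nu : Fac -> 'rV[int]_r.
Local Notation K := (ZGK r).

Definition IAmat (f' f : Fac) : K := (f' == f)%:R + Amat om nu f' f.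

Lemma IAmat_label f' t a b c d : label t a b c d ->
  IAmat f' (face_of (t, d)) = (face_of (t, d) == f')%:R +
  (face_of (t, b) == f')%:R * mono (nu (face_of (t, d)) + om f' - nu f').
Proof. by move=> abcd; rewrite /IAmat (Amat_label Htau om nu f' abcd) eq_sym. Qed.

(** The face [abc] contributes [ab - ac - bc] and its image [acd] contributes [ac - ad - cd]. The
    edge [ac] cancels, and what remains is the relation of the tetrahedron. *)
Lemma LDmat_IAmat e t a b c d : label t a b c d ->
  \sum_f LDmat lam nu e f * IAmat f (face_of (t, d)) =
  mono (nu (face_of (t, d)) + lam t a b) * Lmat lam e (edge_of t a b).
Proof.
move=> abcd; under eq_bigr => f _.
  rewrite (IAmat_label _ abcd) mulrDr [_ * (_%:R * _)]mulrCA [_ * _%:R]mulrC; over.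
rewrite big_split /= !sum_delta_l (Lmat_label Htau Hlam e abcd).
rewrite (LDmat_top Htau Hlam nu e abcd) (LDmat_bottom Htau Hlam nu e (label_flat abcd)).
by rewrite !monoB !monoD monoN; apply: relation_arith; apply: mono_neq0.
Qed.

Variables va vb vc vd : Tet -> 'I_4.
Hypothesis lab : forall t, label t (va t) (vb t) (vc t) (vd t).

Definition bottom1 t := face_of (t, vd t).
Definition bottom2 t := face_of (t, vc t).
Definition top1 t := face_of (t, vb t).
Definition top2 t := face_of (t, va t).

Let flab t := label_flat (lab t).
Let lab' t := label_swap Htau (lab t).

Lemma bottom1_inj : injective bottom1.
Proof.
move=> t t' /(face_inj Htau) []//.
by have /and5P[_ _ _ _ /negPf ->] := flab t; have /and5P[_ _ _ _ /negPf ->] := flab t'.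
Qed.

Lemma bottom2_inj : injective bottom2.
Proof.
move=> t t' /(face_inj Htau) []//.
by have /and5P[_ _ _ /negPf -> _] := flab t; have /and5P[_ _ _ /negPf -> _] := flab t'.
Qed.

Lemma bottom12_neq t t' : bottom1 t != bottom2 t'.
Proof.
apply/eqP => /(face_inj Htau) [].
  by have /and5P[_ _ _ _ /negPf ->] := flab t; have /and5P[_ _ _ /negPf -> _] := flab t'.
by move=> <- E; have [_ _ _ _ [_]] := flat_neq (flab t); rewrite E eqxx.
Qed.

Lemma top1_inj : injective top1.
Proof.
move=> t t' /(face_inj Htau) []//.
by have /and5P[_ _ -> _ _] := flab t; have /and5P[_ _ -> _ _] := flab t'.
Qed.

Lemma top2_inj : injective top2.
Proof.
move=> t t' /(face_inj Htau) []//.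
by have /and5P[_ -> _ _ _] := flab t; have /and5P[_ -> _ _ _] := flab t'.
Qed.

Lemma top12_neq t t' : top1 t != top2 t'.
Proof.
apply/eqP => /(face_inj Htau) [].
  by have /and5P[_ _ -> _ _] := flab t; have /and5P[_ -> _ _ _] := flab t'.
by move=> <- E; have [+ _ _ _ _] := flat_neq (flab t); rewrite E eqxx.
Qed.

Lemma IAmat_bottom1 f t : IAmat f (bottom1 t) =
  (bottom1 t == f)%:R + (top1 t == f)%:R * mono (nu (bottom1 t) + om f - nu f).
Proof. exact: IAmat_label. Qed.

Lemma IAmat_bottom2 f t : IAmat f (bottom2 t) =
  (bottom2 t == f)%:R + (top2 t == f)%:R * mono (nu (bottom2 t) + om f - nu f).
Proof. exact: IAmat_label (lab' t). Qed.

Lemma bottomP f : exists t, bottom1 t = f \/ bottom2 t = f.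
Proof.
have [t [a [b [c [d [/label_flat abcd ->]]]]]] := face_label Htau f; exists t.
have /and5P[_ _ _ _] := abcd; rewrite (flat_bot d (flab t)).
by move=> /orP[] /eqP ->; [right | left].
Qed.

Lemma topP f : exists t, top1 t = f \/ top2 t = f.
Proof.
have [[t k] <-] := face_of_surj Htau f.
wlog tk : t k / topf t k.
  move=> IH; have [|tk] := boolP (topf t k); first exact: IH.
  have := IH (glue (t, k)).1 (glue (t, k)).2; rewrite -surjective_pairing.
  have -> : face_of (glue (t, k)) = face_of (t, k).
    by apply/(face_of_fiber Htau); right; rewrite (glue_invol Htau).
  by apply; have := coorient Htau (t, k); rewrite /= (negPf tk); case: topf.
exists t; move: tk; rewrite (flat_top k (flab t)) => /orP[] /eqP ->; first by right.
by left.
Qed.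

(* the image under [I + A] of the generator of the kernel of "bottom edge"
   supported on the two bottom faces of [t] *)
Definition IAker (f : Fac) (t : Tet) : K :=
  IAmat f (bottom1 t) * mono (- nu (bottom1 t)) -
  IAmat f (bottom2 t) * mono (- nu (bottom2 t)).

(** The weights in the kernel generator cancel the chosen lifts of the bottom faces, so that [nu]
    survives only as a unit attached to the row. *)
Lemma IAkerE f t : IAker f t = mono (- nu f) *
  ((bottom1 t == f)%:R - (bottom2 t == f)%:R +
   ((top1 t == f)%:R - (top2 t == f)%:R) * mono (om f)).
Proof.
have deltaE g : (g == f)%:R * mono (- nu g) = (g == f)%:R * mono (- nu f) :> K.
  by case: eqP => [->|]; rewrite ?mul0r.
rewrite /IAker IAmat_bottom1 IAmat_bottom2 !mulrDl !deltaE !monoB !monoD !monoN.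
rewrite !column_arith ?mono_neq0 // -mulrBr; congr (_ * _).
by rewrite mulNr opprD addrACA.
Qed.

Variables up dn : Fac -> Tet.
Hypothesis upP : forall f, bottom1 (up f) = f \/ bottom2 (up f) = f.
Hypothesis dnP : forall f, top1 (dn f) = f \/ top2 (dn f) = f.

Let sup f := bottom2 (up f) == f.
Let sdn f := top2 (dn f) == f.

(** A face is a bottom face of one tetrahedron and a top face of one, hence an edge of the dual
    graph. Its sign compares its positions in the numberings of these two pairs of faces. *)
Lemma IAker_gain f t : IAker f t = mono (- nu f) * (-1) ^+ sup f *
  gain_incidence up dn (fun f => sup f (+) sdn f) om f t.
Proof.
have upE : (bottom1 t == f)%:R - (bottom2 t == f)%:R = (-1) ^+ sup f * (t == up f)%:R :> K.
  rewrite /sup; case: (upP f) => fE; rewrite -{1 2}fE.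
    rewrite (inj_eq bottom1_inj) ![bottom2 _ == _]eq_sym (negPf (bottom12_neq _ _)).
    by rewrite -fE eq_sym (negPf (bottom12_neq _ _)) subr0 mul1r.
  by rewrite (inj_eq bottom2_inj) (negPf (bottom12_neq _ _)) fE eqxx sub0r mulN1r.
have dnE : (top1 t == f)%:R - (top2 t == f)%:R = (-1) ^+ sdn f * (t == dn f)%:R :> K.
  rewrite /sdn; case: (dnP f) => fE; rewrite -{1 2}fE.
    rewrite (inj_eq top1_inj) ![top2 _ == _]eq_sym (negPf (top12_neq _ _)).
    by rewrite -fE eq_sym (negPf (top12_neq _ _)) subr0 mul1r.
  by rewrite (inj_eq top2_inj) (negPf (top12_neq _ _)) fE eqxx sub0r mulN1r.
rewrite IAkerE upE dnE /gain_incidence -[RHS]mulrA; congr (_ * _).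
rewrite mulrDr signr_addb; congr (_ + _).
rewrite !mulrA -signr_addb addbb mul1r -!mulrA; congr (_ * _); exact: mulrC.
Qed.

Section Minors.
Variables (kappa : Edg -> Fac) (iota : Tet -> Fac).
Hypothesis phi_bij : bijective (sum_fun kappa iota).
Let phi := sum_fun kappa iota.

(* [Q] selects the rows [iota]; the columns of [C] are lifts of the edges along
   "bottom edge" followed by a basis of its kernel, so [C] is invertible and
   [Q * (I + A) * C] is block triangular. *)
Lemma minor_relation : exists2 u, trivial_unit u &
  AB_poly om nu * detI (fun e' e => LDmat lam nu e' (kappa e)) =
  u * (veering_poly lam * detI (fun t t' => IAker (iota t) t')).
Proof.
have [beta botK betaK] := bot_edge_bij Htau lab.
(* A second indexing of the faces: the first bottom face over each edge, followed by all second
   bottom faces. *)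
pose psi := sum_fun (fun e => bottom1 (beta e)) bottom2.
have cardF : #|Fac| = (#|Edg| + #|Tet|)%N.
  by rewrite -card_sum; apply: esym (bij_eq_card phi_bij).
have psi_inj : injective psi.
  move=> [e|t] [e'|t'] /= E.
  - by rewrite (can_inj betaK (bottom1_inj E)).
  - by have := bottom12_neq (beta e) t'; rewrite E eqxx.
  - by have := bottom12_neq (beta e') t; rewrite E eqxx.
  - by rewrite (bottom2_inj E).
have psi_bij : bijective psi.
  by apply: inj_card_bij => //; rewrite card_sum cardF.
have [psi' psiK psi'K] := psi_bij.
have phi_inj : injective phi by apply: bij_inj.
have s_inj : injective (psi' \o phi) by apply: inj_comp; first exact: can_inj psi'K.
pose s := perm s_inj.
have psi_s x : psi (s x) = phi x by rewrite permE /= psi'K.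
pose Q (x : Edg + Tet) f : K :=
  match x with inl e => LDmat lam nu e f | inr t => (iota t == f)%:R end.
(* The weight that cancels the unit in [LDmat_IAmat], so that the edge block of the product is
   [Lmat] itself. *)
pose w e := nu (bottom1 (beta e)) + lam (beta e) (va (beta e)) (vb (beta e)).
pose C f (x : Edg + Tet) : K := match x with
  | inl e => (bottom1 (beta e) == f)%:R * mono (- w e)
  | inr t => (bottom1 t == f)%:R * mono (- nu (bottom1 t)) -
             (bottom2 t == f)%:R * mono (- nu (bottom2 t)) end.
have iota_inj : injective iota.
  by move=> t t' E; have [] := phi_inj (inr t) (inr t') E.
have detQ : detI (fun x y => Q x (phi y)) = detI (fun e' e => LDmat lam nu e' (kappa e)).
  rewrite detI_ublock => [|t e] /=.
    rewrite -[RHS]mulr1; congr (_ * _).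
    rewrite (eq_detI (N := fun t t' => 1 *+ (t == t'))) ?detI_diag ?big1 // => t t'.
    by rewrite (inj_eq iota_inj).
  by have -> // : (iota t == kappa e) = false; apply: (inj_eq phi_inj (inr t) (inl e)).
(* Up to the permutation [s] the rows may be indexed by [psi]; then [C] is block triangular, with
   diagonal blocks that are diagonal matrices of trivial units. *)
have detC : trivial_unit (detI (fun x y => C (phi x) y)).
  rewrite (eq_detI (N := fun x y => C (psi (s x)) y)); last by move=> x y; rewrite psi_s.
  rewrite (detI_row_perm s (fun x y => C (psi x) y)); apply: trivial_unitM.
    exact: trivial_unit_sign.
  rewrite detI_ublock => [|t e] /=; last by rewrite (negPf (bottom12_neq _ _)) mul0r.
  apply: trivial_unitM.
    rewrite (eq_detI (N := fun e e' => mono (- w e) *+ (e == e'))).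
      by rewrite detI_diag; apply: trivial_unit_prod => e; apply: trivial_unit_mono.
    move=> e e'; rewrite (inj_eq bottom1_inj) (inj_eq (can_inj betaK)) eq_sym.
    by case: eqP => [->|]; rewrite ?mul1r ?mul0r.
  rewrite (eq_detI (N := fun t t' => - mono (- nu (bottom2 t)) *+ (t == t'))).
    rewrite detI_diag; apply: trivial_unit_prod => t.
    exact/trivial_unitN/trivial_unit_mono.
  move=> t t'; rewrite (inj_eq bottom2_inj) (negPf (bottom12_neq _ _)) mul0r sub0r eq_sym.
  by case: eqP => [->|]; rewrite ?mul1r ?mul0r ?oppr0.
pose QB x f := \sum_g Q x g * IAmat g f.
have sum_phi (F : Fac -> K) : \sum_x F (phi x) = \sum_f F f.
  by rewrite [RHS](reindex phi) //; apply: onW_bij.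
have detQB : detI (fun x y => QB x (phi y)) =
    detI (fun e' e => LDmat lam nu e' (kappa e)) * AB_poly om nu.
  rewrite -detQ /AB_poly (detI_reindex phi_bij) -detI_mul; apply: eq_detI => x y.
  exact: esym (sum_phi (fun g => Q x g * IAmat g (phi y))).
have detQBC : detI (fun x z => \sum_f QB x f * C f z) =
    detI (fun x y => QB x (phi y)) * detI (fun x y => C (phi x) y).
  rewrite -detI_mul; apply: eq_detI => x z.
  exact: esym (sum_phi (fun f => QB x f * C f z)).
have sum_delta x g z : \sum_f QB x f * ((g == f)%:R * z) = QB x g * z.
  by under eq_bigr do rewrite mulrCA; rewrite sum_delta_l.
have QB_edge e t a b c d : label t a b c d ->
    QB (inl e) (face_of (t, d)) = mono (nu (face_of (t, d)) + lam t a b) * Lmat lam e (edge_of t a b).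
  exact: LDmat_IAmat.
exists (detI (fun x y => C (phi x) y))^-1; first exact: trivial_unitV.
apply: (mulfI (trivial_unit_neq0 detC)); rewrite mulVKf ?trivial_unit_neq0 //.
rewrite [AB_poly om nu * _]mulrC -detQB mulrC -detQBC detI_lblock => [|e t] /=.
  congr (_ * _); apply: eq_detI.
    move=> e' e; rewrite sum_delta (QB_edge _ _ _ _ _ _ (lab _)) -/(bottom1 _) -/(w e).
    rewrite mulrAC -monoD subrr mono0 mul1r; congr (Lmat _ _ _); exact: betaK.
  move=> t' t; under eq_bigr do rewrite mulrBr.
  rewrite sumrB !sum_delta /QB /= !sum_delta_l. by [].
(* The vanishing block: the two bottom faces of [t] lie over the same bottom edge, and the weights
   make their images equal. *)
under eq_bigr do rewrite mulrBr.
rewrite sumrB !sum_delta (QB_edge _ _ _ _ _ _ (lab _)) (QB_edge _ _ _ _ _ _ (lab' _)).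
rewrite (edge_of_sym Htau t (vb t)) (lam_sym Hlam t (vb t)) -/(bottom1 t) -/(bottom2 t).
rewrite !monoD !monoN ![_ * mono (lam _ _ _)]mulrC -!mulrA.
by rewrite ![Lmat _ _ _ / _]mulrC !mulVKf ?mono_neq0 // ?mulKVf ?mono_neq0 ?subrr.
Qed.

End Minors.
End Relation.

(** * The product over AB-cycles *)

Section ABCycles.
Variable tau : triangulation.
Hypothesis Htau : veering_triangulation tau.

Local Notation Fac := (@Fac tau).
Local Notation topf := (@topf tau).
Local Notation face_of := (@face_of tau).

Variables (r : nat) (om nu : Fac -> 'rV[int]_r).
Local Notation K := (ZGK r).
Local Notation A := (@Aperm tau).

(** The top face gives [t] and [b], hence [a]. The only other candidate exchanges [c] and [d], and
    is excluded because [ac] and [ad] have different veers. *)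
Lemma Aperm_inj : injective A.
Proof.
move=> f f'; have [t [a [b [c [d [abcd ->]]]]]] := face_label Htau f.
have [t' [a' [b' [c' [d' [abcd' ->]]]]]] := face_label Htau f'.
rewrite (Aperm_label Htau abcd) (Aperm_label Htau abcd').
have fl := label_flat abcd; have fl' := label_flat abcd'.
have /and5P[_ _ tb _ _] := fl; have /and5P[_ _ tb' _ td'] := fl'.
move=> /(face_inj Htau) [|tE bE]; first by rewrite tb tb'.
subst t' b'; have := flat_bot d' fl; rewrite td' => /esym /orP[] /eqP d'E; last by rewrite d'E.
have c'E : c' = d.
  have /and5P[_ _ _ tc' _] := fl'; have := flat_bot c' fl; rewrite tc' => /esym /orP[] /eqP // c'c.
  by have [_ _ _ _ [_]] := flat_neq fl'; rewrite d'E c'c eqxx.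
have a'E : a' = a.
  have /and5P[_ ta' _ _ _] := fl'; have := flat_top a' fl; rewrite ta' => /esym /orP[] /eqP // a'b.
  by have [] := flat_neq fl'; rewrite a'b eqxx.
subst a' c' d'; have /andP[_ /eqP] := abcd'; have /andP[_ /eqP] := abcd.
rewrite (flat_veer_ad Htau fl) (edge_of_sym Htau t d c) => ->.
by case: right_veer.
Qed.

Lemma IAmat_Aperm f' f : IAmat om nu f' f =
  (f == f')%:R + (A f == f')%:R * mono (nu f + om f' - nu f').
Proof.
have [t [a [b [c [d [abcd ->]]]]]] := face_label Htau f.
by rewrite (Aperm_label Htau abcd) (IAmat_label Htau om nu f' abcd).
Qed.

Lemma sum_IAmat f' (h : Fac -> K) : \sum_f IAmat om nu f' f * h f =
  h f' + mono (nu (finv A f') + om f' - nu f') * h (finv A f').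
Proof.
rewrite (eq_bigr (fun f => (f' == f)%:R * h f + (finv A f' == f)%:R *
    (mono (nu f + om f' - nu f') * h f))) => [|f _].
  by rewrite big_split /= !sum_delta_l.
rewrite IAmat_Aperm mulrDl -mulrA eq_sym.
suff -> : (A f == f') = (finv A f' == f) by [].
by apply/eqP/eqP => <-; rewrite (finv_f Aperm_inj, f_finv Aperm_inj).
Qed.

(** Each cycle is cut open at its root, and [n] counts the steps from there. The vector [h] is
    propagated so that every row but the root's kills it; the root row closes the cycle and yields
    the factor. *)
Lemma AB_poly_product : AB_poly om nu = AB_product om.
Proof.
have A_sym := fconnect_sym Aperm_inj.
have root_A f : froot A (A f) = froot A f.
  by apply/eqP; rewrite (root_connect A_sym) A_sym fconnect1.
pose n f := findex A (froot A f) f.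
have nP f : iter (n f) A (froot A f) = f.
  by apply: iter_findex; rewrite A_sym connect_root.
have n_lt f : (n f < fingraph.order A (froot A f))%N.
  by apply: findex_max; rewrite A_sym connect_root.
have nA f : froot A (A f) != A f -> n (A f) = (n f).+1.
  rewrite root_A => rA; have Ef : A f = iter (n f).+1 A (froot A f) by rewrite /= nP.
  rewrite /n root_A {1}Ef findex_iter // ltn_neqAle n_lt andbT.
  by apply: contraNneq rA => nE; rewrite Ef nE iter_order ?eqxx //; apply: Aperm_inj.
(* The sum includes [f] but not the root, whose [om] enters only when the cycle is closed. *)
pose S f := \sum_(g <- traject A (A (froot A f)) (n f)) om g.
pose h f := (-1) ^+ n f * mono (nu (froot A f) - nu f + S f) : K.
rewrite -[AB_poly om nu]/(detI (IAmat om nu)) (@detI_forest _ _ (froot A) n h).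
- rewrite /AB_product [RHS]big_mkcond; apply: eq_bigr => f _; case: ifP => [/eqP rf|rf].
    rewrite sum_IAmat; set g := finv A f.
    have fE : f = A g by rewrite f_finv //; apply: Aperm_inj.
    have rg : froot A g = f by rewrite -root_A -fE.
    have og : n g = (fingraph.order A f).-1.
      by rewrite /n rg /g /finv findex_iter // prednK ?fingraph.order_gt0.
    have hf : h f = 1.
      by rewrite /h /S /n rf findex0 big_nil subrr addr0 mono0 mulr1.
    rewrite hf /h /S og rg; congr (_ + _).
    rewrite mulrCA -monoD /fingraph.orbit.
    case: (fingraph.order A f) (fingraph.order_gt0 A f) => // k _.
    rewrite /= big_cons !exprS !mulN1r opprK.
    by congr (_ * mono _); rewrite -!addrA addKr addrCA addNKr.
  (* A face fixed by [A] is its own root, so the diagonal entry of a non-root is 1. *)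
  rewrite IAmat_Aperm eqxx; case: eqP => [Af|]; last by rewrite mul0r addr0.
  by have := nA f; rewrite Af rf => /(_ erefl) /n_Sn.
- exact: root_root.
- move=> f' f; rewrite IAmat_Aperm => ne.
  case: eqP => [E|_]; first by rewrite E eqxx in ne.
  case: eqP => [E|_]; first by rewrite -E root_A eqxx in ne.
  by rewrite add0r mul0r.
- by move=> f rf; rewrite /h /S /n rf findex0 big_nil subrr addr0 mono0 mulr1.
- move=> f rf; rewrite sum_IAmat; set g := finv A f.
  have fE : f = A g by rewrite f_finv //; apply: Aperm_inj.
  have nf : n f = (n g).+1 by rewrite fE nA // -fE.
  have rg : froot A g = froot A f by rewrite -root_A -fE.
  have lastE : iter (n g) A (A (froot A f)) = f by rewrite -iterSr /= -rg nP -fE.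
  rewrite /h /S nf rg trajectSr lastE -cats1 big_cat big_seq1 /=.
  rewrite exprS mulN1r mulNr mulrCA -monoD; apply/eqP; rewrite addr_eq0 eqr_opp; apply/eqP.
  congr (_ * mono _); move: (\sum_(_ <- _) _) => X.
  by apply/rowP => i; rewrite !mxE; ring.
- move=> f' f rf ne le_n; rewrite IAmat_Aperm eq_sym (negPf ne).
  case: eqP => [E|_]; last by rewrite add0r mul0r.
  by move: le_n; rewrite -E nA ?E // ltnn.
Qed.

End ABCycles.

(** * The factorization *)

Lemma detI_scale_rows (R : comPzRingType) (I : finType) (d : I -> R) (M : I -> I -> R) :
  detI (fun i j => d i * M i j) = (\prod_i d i) * detI M.
Proof.
rewrite /detI big_distrr; apply: eq_bigr => s _ /=.
by rewrite big_split /= mulrCA.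
Qed.

Lemma inj_surj_bij (I : finType) (J : Type) (f : J -> I) :
  injective f -> (forall i, exists j, f j = i) -> bijective f.
Proof.
by move=> f_inj /fin_all_exists[g gK]; exists g => // j; apply: f_inj.
Qed.

Section Wedge.
Variable r : nat.
Local Notation V := 'rV[int]_r.+2.

(** The minor on the first two coordinates. For fixed [v] it is an additive form vanishing at [v],
    which is the form needed for the regularity of binomials. *)
Definition wedge (v w : V) : int :=
  v 0 0 * w 0 (lift 0 0) - v 0 (lift 0 0) * w 0 0.

Lemma wedgeDr (v : V) : {morph wedge v : x y / x + y}.
Proof. by move=> x y; rewrite /wedge !mxE; ring. Qed.

Lemma wedgevv (v : V) : wedge v v = 0.
Proof. by rewrite /wedge; ring. Qed.

Lemma wedge0v (v : V) : wedge 0 v = 0.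
Proof. by rewrite /wedge !mxE; ring. Qed.

Lemma wedge_sumr (F : finType) (g : F -> V) (c : F -> int) (v : V) :
  wedge v (\sum_f g f *~ c f) = \sum_f wedge v (g f) * c f.
Proof.
rewrite (big_morph _ (wedgeDr v) (_ : wedge v 0 = 0)); last by rewrite /wedge !mxE; ring.
apply: eq_bigr => f _; rewrite -scaler_int /wedge !mxE; ring.
Qed.

Lemma wedgeC (v w : V) : wedge v w = - wedge w v.
Proof. by rewrite /wedge; ring. Qed.

(** The first two basis vectors have wedge 1, so by bilinearity the wedges of the generators cannot
    all vanish. *)
Lemma spanning_wedge (F : finType) (g : F -> V) :
  (forall v, exists c : F -> int, \sum_f g f *~ c f = v) ->
  exists f1 f2, wedge (g f1) (g f2) != 0.
Proof.
move=> span.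
suff /existsP[f1 /existsP[f2 ?]] : [exists f1, exists f2, wedge (g f1) (g f2) != 0].
  by exists f1, f2.
apply: contraT => nowedge.
have {}nowedge f1 f2 : wedge (g f1) (g f2) = 0.
  apply/eqP; apply: contraNT nowedge => ?.
  by apply/existsP; exists f1; apply/existsP; exists f2.
have [c cE] := span (delta_mx 0 0); have [d dE] := span (delta_mx 0 (lift 0 0)).
have : wedge (delta_mx 0 0) (delta_mx 0 (lift 0 0)) = 0.
  rewrite -dE wedge_sumr big1 // => f _; rewrite wedgeC -cE wedge_sumr big1 ?oppr0 ?mul0r //.
  by move=> f' _; rewrite nowedge mul0r.
by rewrite /wedge !mxE.
Qed.

End Wedge.

Lemma cross_cofactors (R : comPzRingType) (b th l c1 c2 m1 m2 : R) :
  b * (c1 * th) = l * m1 -> b * (c2 * th) = l * m2 ->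
  b * th * (c1 * m2) = b * th * (c2 * m1).
Proof.
move=> E1 E2; transitivity (b * (c1 * th) * m2); first by ring.
by rewrite E1 mulrAC -E2; ring.
Qed.

Lemma cancel_cofactor (F : fieldType) (x b c th : F) :
  x != 0 -> x * (b * (c / x * th)) = b * (c * th).
Proof. by move=> x_neq0; field. Qed.

Lemma regroup_cofactor (R : comPzRingType) (u w b th d : R) :
  u * (w * (b * th) * d) = b * (u * d * (w * th)).
Proof. by ring. Qed.

(* [b], [th], [l] stand for the AB-polynomial, the taut polynomial and the
   veering polynomial; [m1], [m2] are the two coprime minors. *)
Lemma common_factor (r : nat) (b th l : ZGK r) (lin : 'rV[int]_r -> int)
    (e1 e2 : bool) (g1 g2 : 'rV[int]_r) (c1 c2 : ZGK r) :
  {morph lin : v w / v + w} -> lin g1 = 0 -> lin g2 != 0 -> g1 != 0 ->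
  inZG c1 -> inZG c2 ->
  b * (c1 * th) = l * (1 - (-1) ^+ e1 * mono g1) ->
  b * (c2 * th) = l * (1 - (-1) ^+ e2 * mono g2) ->
  exists2 w, inZG w & l = w * (b * th).
Proof.
move=> linD lin1 lin2 g1_neq0 c1Z c2Z E1 E2.
have m1_neq0 : 1 - (-1) ^+ e1 * mono g1 != 0.
  rewrite subr_eq0; apply: contraNneq g1_neq0 => E.
  apply/eqP; apply: (@mono_eq_sign r e1); apply: (mulfI (_ : (-1) ^+ e1 != 0)); first by rewrite signr_eq0.
  by rewrite -E -signr_addb addbb.
have [bth0|bth_neq0] := eqVneq (b * th) 0.
  exists 0; first exact: inZG0.
  apply/eqP; have/eqP := E1; rewrite mulrCA bth0 mulr0 eq_sym mulf_eq0 (negPf m1_neq0) orbF.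
  by rewrite mul0r.
(* Eliminating [l] from [E1] and [E2] gives the syzygy between the two binomials. *)
have [w wZ wE] : exists2 w, inZG w & c1 = w * (1 - (-1) ^+ e1 * mono g1).
  apply: (binomial_regular linD lin1 lin2 c1Z c2Z).
  by apply: (mulfI bth_neq0); apply: cross_cofactors E1 E2.
exists w => //; apply: (mulIf m1_neq0); rewrite -E1 wE.
by rewrite [_ * _ * th]mulrAC [LHS]mulrA [b * _]mulrCA.
Qed.

Section Assembly.
Variable tau : triangulation.
Hypothesis Htau : veering_triangulation tau.

Local Notation Tet := (@Tet tau).
Local Notation glue := (@glue tau).
Local Notation topf := (@topf tau).
Local Notation Fac := (@Fac tau).
Local Notation face_of := (@face_of tau).
Local Notation Edg := (@Edg tau).

Variables va vb vc vd : Tet -> 'I_4.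
Hypothesis lab : forall t, label t (va t) (vb t) (vc t) (vd t).

Local Notation bottom1 := (bottom1 vd).
Local Notation bottom2 := (bottom2 vc).
Local Notation top1 := (top1 vb).
Local Notation top2 := (top2 va).

Lemma bottoms_bij : bijective (sum_fun bottom1 bottom2).
Proof.
apply: inj_surj_bij => [[t|t] [t'|t'] /= E|f].
- by rewrite (bottom1_inj Htau lab E).
- by have := bottom12_neq Htau lab t t'; rewrite E eqxx.
- by have := bottom12_neq Htau lab t' t; rewrite E eqxx.
- by rewrite (bottom2_inj Htau lab E).
by have [t [] <-] := bottomP Htau lab f; [exists (inl t) | exists (inr t)].
Qed.

Lemma tops_bij : bijective (sum_fun top1 top2).
Proof.
apply: inj_surj_bij => [[t|t] [t'|t'] /= E|f].
- by rewrite (top1_inj Htau lab E).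
- by have := top12_neq Htau lab t t'; rewrite E eqxx.
- by have := top12_neq Htau lab t' t; rewrite E eqxx.
- by rewrite (top2_inj Htau lab E).
by have [t [] <-] := topP Htau lab f; [exists (inl t) | exists (inr t)].
Qed.

(** Each tetrahedron has two bottom faces and one bottom edge, and every face and every edge arises
    exactly once in this way. *)
Lemma card_faces : #|Fac| = (#|Edg| + #|Tet|)%N.
Proof.
rewrite -(bij_eq_card bottoms_bij) card_sum; congr (_ + _)%N.
exact: bij_eq_card (bot_edge_bij Htau lab).
Qed.

Lemma sum_by_bottoms (V : zmodType) (G : Fac -> V) :
  \sum_f G f = \sum_t (G (bottom1 t) + G (bottom2 t)).
Proof. by rewrite (reindex _ (onW_bij _ bottoms_bij)) big_sumType big_split. Qed.

Lemma sum_by_tops (V : zmodType) (G : Fac -> V) :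
  \sum_f G f = \sum_t (G (top1 t) + G (top2 t)).
Proof. by rewrite (reindex _ (onW_bij _ tops_bij)) big_sumType big_split. Qed.

Lemma dual_cycle_balance (c : Fac -> int) t : dual_cycle c ->
  c (top1 t) + c (top2 t) = c (bottom1 t) + c (bottom2 t).
Proof.
move=> /(_ t); have /and5P[abcd ta tb /negPf tc /negPf td] := label_flat (lab t).
have E : perm_eq [:: va t; vb t; vc t; vd t] (index_enum 'I_4).
  apply: uniq_perm => //; first exact: index_enum_uniq.
  by move=> i; rewrite mem_index_enum !inE ord4_cover.
rewrite -(perm_big _ E) !big_cons big_nil /= ta tb tc td.
rewrite -/(bottom1 t) -/(bottom2 t) -/(top1 t) -/(top2 t); lia.
Qed.

Variables up dn : Fac -> Tet.
Hypothesis upP : forall f, bottom1 (up f) = f \/ bottom2 (up f) = f.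
Hypothesis dnP : forall f, top1 (dn f) = f \/ top2 (dn f) = f.

Lemma up_face t k : ~~ topf t k -> up (face_of (t, k)) = t.
Proof.
move=> /negPf tk; have /and5P[_ _ _ /negPf tc /negPf td] := label_flat (lab (up (face_of (t, k)))).
by case: (upP (face_of (t, k))) => /(face_inj Htau) [] //; rewrite tk.
Qed.

Lemma dn_face t k : topf t k -> dn (face_of (t, k)) = t.
Proof.
move=> tk; have /and5P[_ ta tb _ _] := label_flat (lab (dn (face_of (t, k)))).
by case: (dnP (face_of (t, k))) => /(face_inj Htau) [] //; rewrite tk.
Qed.

Lemma joins_connected t t' : connect (joins up dn) t t'.
Proof.
apply: (connect_sub _ (tet_connected Htau t t')) => u u' /existsP[k /eqP <-].
apply: connect1; apply/existsP; exists (face_of (u, k)).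
have := glue_top Htau u k; have := glue_face Htau u k.
have [uk|uk] := boolP (topf u k) => <- gk.
  by rewrite up_face ?gk // glue_face // dn_face // !eqxx orbT.
by rewrite dn_face ?gk // glue_face // up_face // !eqxx.
Qed.

(** A coboundary pairs to 0 with a cycle: around each tetrahedron the top and the bottom faces
    balance. *)
Lemma dual_cycle_telescope (V : zmodType) (eta : Tet -> V) (c : Fac -> int) :
  dual_cycle c -> \sum_f (eta (dn f) - eta (up f)) *~ c f = 0.
Proof.
move=> c_cycle; under eq_bigr do rewrite mulrzBl; rewrite sumrB.
rewrite sum_by_tops [X in _ - X]sum_by_bottoms.
apply/eqP; rewrite subr_eq0; apply/eqP/eq_bigr => t _.
have /and5P[_ ta tb tc td] := label_flat (lab t).
rewrite /top1 /top2 /bottom1 /bottom2 !dn_face // !up_face // -!mulrzDr.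
by congr (_ *~ _); apply: dual_cycle_balance.
Qed.

Variables (r : nat) (om : Fac -> 'rV[int]_r).
Variable nu : Fac -> 'rV[int]_r.

Lemma inZG_IAker f t : inZG (IAker om nu vc vd f t).
Proof.
rewrite (IAkerE Htau om nu lab); apply: inZG_M; first exact: inZG_mono.
apply: inZG_D; first by apply: inZG_B; apply: inZG_nat.
by apply: inZG_M; [apply: inZG_B; apply: inZG_nat | apply: inZG_mono].
Qed.
End Assembly.

Theorem mainTheorem16 (tau : triangulation) (Htau : veering_triangulation tau)
  (r : nat) (Hr : (1 < r)%N)
  (om : Fac tau -> 'rV[int]_r) (Hom : G_identification om)
  (lam : Tet tau -> 'I_4 -> 'I_4 -> 'rV[int]_r) (Hlam : lift_rule om lam)
  (nu : Fac tau -> 'rV[int]_r)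
  (Theta : ZGK r) (HTheta : is_taut_poly lam nu Theta) :
  assocZG (veering_poly lam) (AB_poly om nu * Theta) /\
  assocZG (veering_poly lam) (Theta * AB_product om).
Proof.
suff veering_assoc : assocZG (veering_poly lam) (AB_poly om nu * Theta).
  by split; last by rewrite mulrC -(AB_poly_product Htau om nu).
case: r Hr om Hom lam Hlam nu Theta HTheta => [|[|r]] // _ om [_ om_span _] lam Hlam nu Theta.
case=> ThetaZ Theta_dvd Theta_max.
have /fin_all_exists[va /fin_all_exists[vb /fin_all_exists[vc /fin_all_exists[vd lab]]]] :
  forall t, exists a b c d, label t a b c d := label_ex Htau.
have /fin_all_exists[up upP] := bottomP Htau lab.
have /fin_all_exists[dn dnP] := topP Htau lab.
(* Without faces the values of [om] could not span a nonzero group. *)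
have [f0 _|no_face] := pickP (fun _ : Fac tau => true); last first.
  have [c [_ /rowP/(_ 0)]] := om_span (delta_mx 0 0).
  by rewrite big_pred0 // !mxE.
have [eta [e minors]] := gain_minors
  (fun f => (bottom2 vc (up f) == f) (+) (top2 va (dn f) == f)) om (up f0) f0
  (joins_connected Htau lab upP dnP).
pose g f := om f + eta (dn f) - eta (up f).
(* Changing [om] by the coboundary of [eta] is invisible to cycles, so the circuit classes [g f]
   span as well. *)
have g_span v : exists c : Fac tau -> int, \sum_f g f *~ c f = v.
  have [c [c_cycle <-]] := om_span v; exists c.
  under eq_bigr do rewrite /g -addrA mulrzDl.
  by rewrite big_split (dual_cycle_telescope Htau lab upP dnP eta c_cycle) /= addr0.
have [f1 [f2 wedge_neq0]] := spanning_wedge g_span.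
have g1_neq0 : g f1 != 0 by apply: contraNneq wedge_neq0 => ->; rewrite wedge0v.
have card_F := card_faces Htau lab.
(* Here [c] is, up to a unit, the cofactor of [Theta] in the minor of [L^tri] on the faces
   complementary to the tree and [f]. *)
have relation f : exists2 c, inZG c & AB_poly om nu * (c * Theta) =
    veering_poly lam * (1 - (-1) ^+ e f * mono (g f)).
  have [iota [u u_unit iotaE]] := minors f.
  have [v v_unit IAker_E] : exists2 v, trivial_unit v &
      detI (fun t t' => IAker om nu vc vd (iota t) t') = v * (1 - (-1) ^+ e f * mono (g f)).
    rewrite (eq_detI (fun t t' => IAker_gain Htau om nu lab upP dnP (iota t) t')).
    rewrite detI_scale_rows iotaE mulrA; eexists; last by [].
    apply: trivial_unitM => //; apply: trivial_unit_prod => t.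
    by apply: trivial_unitM; [apply: trivial_unit_mono | apply: trivial_unit_sign].
  have [/injectiveP iota_inj|/injectivePn[t [t' tt' eq_iota]]] := boolP (injectiveb iota).
    have [j phi_bij] := complement_fun iota_inj (etrans card_F (addnC _ _)).
    have phi'_bij : bijective (sum_fun j iota).
      apply: inj_card_bij; last by rewrite card_sum card_F.
      have phi_inj := bij_inj phi_bij.
      by move=> [x|t] [x'|t'] E;
        [case: (phi_inj (inr x) (inr x') E) => -> | case: (phi_inj (inr x) (inl t') E)
        | case: (phi_inj (inl t) (inr x') E) | case: (phi_inj (inl t) (inl t') E) => ->].
    have [w w_unit rel] := minor_relation Htau Hlam nu lab phi'_bij.
    have [|c [cZ cE]] := Theta_dvd [ffun x => j x].
      move=> x x'; rewrite !ffunE => E; have := bij_inj phi'_bij (x1 := inl x) (x2 := inl x') E.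
      by case.
    rewrite IAker_E in rel; exists (c / (w * v)).
      by apply: inZG_M => //; apply/trivial_unit_inZG/trivial_unitV/trivial_unitM.
    have wv_neq0 : w * v != 0 by apply/trivial_unit_neq0/trivial_unitM.
    apply: (mulfI wv_neq0).
    rewrite cancel_cofactor // -cE -[RHS]mulrA [v * _]mulrCA -rel; congr (_ * _).
    by apply: eq_detI => x y; rewrite ffunE.
  (* If [f] repeats a tree edge, the minor vanishes and with it the binomial. *)
  exists 0; first exact: inZG0.
  rewrite mul0r mulr0; move: IAker_E; rewrite (detI_dup_col tt') => [/esym/eqP|k]; last by rewrite eq_iota.
  by rewrite mulf_eq0 (negPf (trivial_unit_neq0 v_unit)) /= => /eqP ->; rewrite mulr0.
have [c1 c1Z rel1] := relation f1; have [c2 c2Z rel2] := relation f2.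
have [w wZ veeringE] := common_factor (wedgeDr (g f1)) (wedgevv _) wedge_neq0
  g1_neq0 c1Z c2Z rel1 rel2.
have [bTh0|bTh_neq0] := eqVneq (AB_poly om nu * Theta) 0.
  by exists false, 0; rewrite veeringE bTh0 !mulr0.
have [b_neq0 Th_neq0] : AB_poly om nu != 0 /\ Theta != 0.
  by apply/andP; rewrite mulf_eq0 negb_or in bTh_neq0.
(* Cancelling the AB-polynomial in the minor relation shows that [w * Theta] divides every minor of
   [L^tri]. By maximality it divides [Theta], which makes [w] invertible. *)
have [|kappa kappa_inj|k [kZ ThE]] := Theta_max (w * Theta); first exact: inZG_M.
  have [j phi_bij] := complement_fun kappa_inj card_F.
  have [u u_unit] := minor_relation Htau Hlam nu lab phi_bij.
  set D := detI (fun t t' => IAker _ _ _ _ _ _); move=> rel; exists (u * D); split.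
    apply: inZG_M; first exact: trivial_unit_inZG.
    by apply: inZG_detI => t t'; apply: inZG_IAker.
  apply: (mulfI b_neq0); rewrite -[LDminor _ _ _]/(detI _) rel veeringE.
  exact: regroup_cofactor.
have [s [h wE]] : exists (s : bool) h, w = (-1) ^+ s * mono h.
  apply: (inZG_unit wZ kZ); apply: (mulIf Th_neq0).
  by rewrite mul1r [RHS]ThE mulrA [k * w]mulrC.
by exists s, h; rewrite veeringE wE.
Qed.
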